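(* There is a constant $c<2$ such that $$\max\{a(X) \mid X \subset \mathbb{R}^3,\ \operatorname{aff} X = \mathbb{R}^3,\ X \text{ is in convex position},\ |X| = n\} \leq \tfrac{2}{5}n^2 + O(n^c).$$
   Context: Here $n\ge 4$ is an integer and the $O(\cdot)$ is as $n\to\infty$. Let $X=\{x_1,\dots,x_n\}\subset\mathbb{R}^d$ be a finite set (with $x_i\neq x_j$ for $i\ne j$) whose affine hull is $\mathbb{R}^d$, and let $P=\operatorname{conv}X$. Two distinct points $x_i,x_j\in X$ are called antipodal (in $X$) if there are different parallel supporting hyperplanes $H',H''$ of $P$ with $x_i\in H'$ and $x_j\in H''$. $a(X)$ denotes the number of (unordered) antipodal pairs $\{x_i,x_j\}$ of $X$. $X$ is in convex position if $X\subset \operatorname{bd}P$ (so points of $X$ need not be vertices of $P$). *)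

(* Defs.v *)
From HB Require Import structures.
From mathcomp Require Import all_boot all_order all_algebra finmap.
From mathcomp Require Import all_classical all_reals all_analysis.
Import Order.TTheory GRing.Theory Num.Theory.
Import numFieldNormedType.Exports.
Set Implicit Arguments.
Unset Strict Implicit.
Unset Printing Implicit Defensive.
Local Open Scope fset_scope.
Local Open Scope classical_set_scope.
Local Open Scope ring_scope.

Section AntipodalPairs.
Variables (R : realType) (d : nat).
Implicit Types (A P H : set 'rV[R]_d) (X : {fset 'rV[R]_d}) (u x y : 'rV[R]_d).

Definition dot u x : R := \sum_(i < d) u 0 i * x 0 i.

Definition affine_set A : Prop :=
  forall x y (t : R), A x -> A y -> A (t *: x + (1 - t) *: y).

Definition aff_hull A : set 'rV[R]_d := smallest affine_set A.

Definition conv_hull A : set 'rV[R]_d := smallest (@convex_set R 'rV[R]_d) A.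

Definition bd A : set 'rV[R]_d := closure A `\` interior A.

(* Replacing (u, b) by (- u, - b) exchanges the two sides of H, so a single
   inequality covers both closed half-spaces. *)
Definition supporting_hyperplane P H : Prop :=
  exists u (b : R), [/\ u != 0, H = [set x | dot u x = b],
    P `<=` [set x | dot u x <= b] & H `&` P !=set0].

Definition parallel H1 H2 : Prop := exists v, H2 = [set v + x | x in H1].

Definition antipodal X x y : Prop :=
  [/\ x \in X, y \in X, x != y &
    exists H1 H2, [/\ supporting_hyperplane (conv_hull [set` X]) H1,
      supporting_hyperplane (conv_hull [set` X]) H2,
      H1 <> H2, parallel H1 H2 & H1 x /\ H2 y]].

Definition nb_antipodal X : nat :=
  #|` [fset e in fpowerset X |
         `[< exists x y, antipodal X x y /\ e = [fset x; y] >]] |.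

Definition convex_position X : Prop := [set` X] `<=` bd (conv_hull [set` X]).

(* For n >= d.+1 > 2 the set below is a finite nonempty set of integers, so its
   supremum is its maximum. *)
Definition max_antipodal (n : nat) : R :=
  sup [set (nb_antipodal X)%:R | X in
         [set X | [/\ aff_hull [set` X] = setT, convex_position X & #|` X| = n]]].

Lemma nb_antipodal_le_max X : aff_hull [set` X] = setT -> convex_position X ->
  (nb_antipodal X)%:R <= max_antipodal #|` X|.
Proof.
move=> Xa Xc; apply: ub_le_sup; last by exists X.
exists (2 ^ #|` X|)%:R => _ [Y [_ _ YX] <-].
rewrite ler_nat -YX -card_fpowerset; apply: fsubset_leq_card.
exact: fset_sub.
Qed.

End AntipodalPairs.

(* Main.v *)
Require Import Defs.
From HB Require Import structures.
From mathcomp Require Import all_boot all_order all_algebra finmap.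
From mathcomp Require Import all_classical all_reals all_analysis.
From mathcomp Require Import lra zify.
Import Order.TTheory GRing.Theory Num.Theory.
Import numFieldNormedType.Exports.
Set Implicit Arguments.
Unset Strict Implicit.
Unset Printing Implicit Defensive.

(* The antipodality graph contains no complete 5-partite graph with large
   classes, so its edge density is asymptotically at most 3/4 < 4/5, and the
   bound holds for large n without any error term.

   In the coordinates of a simplex of maximal volume the points of X lie in a
   cube.  If the graph had more than 2/5 n^2 edges with n large, an Erdos-Stone
   argument would give five pairs of points, the two points of each pair being
   as close as we like, such that points of different pairs are antipodal.  In
   the limit each pair becomes a point a_i with a direction v_i, and convex
   combinations of the four functionals that separate two pairs give a
   functional u_ij orthogonal to v_i and v_j that attains its maximum over
   a_1, ..., a_5 at a_i and its minimum at a_j.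

   This is impossible.  If some directions are parallel or coplanar, one
   reduces to dimension at most two.  Otherwise u_ij is a multiple of
   v_i x v_j.  Among four of the lines, scaled so that the directions sum to 0,
   summing the slab inequalities forces equality in most of them: a_i lies on
   the boundary of the slab of a_j and a_k unless, seen along v_i, the fourth
   line is between these two.  Hence a_i lies on the boundary of five of the
   six slabs of the four other lines.  Such a boundary plane contains a_j and
   is parallel to v_j and v_k; for given j, two of them meet in the line of
   a_j, which does not contain a_i.  So each j accounts for only one slab, and
   there are at most four. *)

(** * Dense graphs *)

Section DenseGraph.
Local Open Scope nat_scope.

Definition select (T : finType) t (A : {set T}) : {set T} := [set x in take t (enum A)].

Lemma select_sub (T : finType) t (A : {set T}) : select t A \subset A.
Proof. by apply/fintype.subsetP => x; rewrite inE => /mem_take; rewrite mem_enum. Qed.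

Lemma card_select (T : finType) t (A : {set T}) : t <= #|A| -> #|select t A| = t.
Proof.
move=> tA; rewrite cardsE (card_uniqP _) ?take_uniq ?enum_uniq // size_take -cardE.
by case: ltngtP tA.
Qed.

(** At most [2 ^ #|U|] values are available for [f] on [A], so some fibre is large. *)
Lemma pigeonhole_trace (T : finType) (A U : {set T}) (f : T -> {set T}) k :
  (forall x, x \in A -> f x \subset U) -> k * 2 ^ #|U| < #|A| ->
  exists Y, k < #|[set x in A | f x == Y]|.
Proof.
move=> fU kA; apply/existsP; rewrite -[[exists _, _]]negbK negb_exists.
apply/negP => /forallP h; move: kA; rewrite ltnNge => /negP; apply.
rewrite -card_powerset mulnC -sum_nat_const.
rewrite -sum1_card (partition_big f (mem (powerset U))) /=; last first.
  by move=> x xA; rewrite inE fU.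
apply: leq_sum => Y _; have := h Y; rewrite -leqNgt; apply: leq_trans.
by rewrite sum1dep_card.
Qed.

Variables (T : finType) (e : rel T).
Hypothesis e_sym : symmetric e.
Implicit Types (S : {set T}) (B : nat -> {set T}).

Definition deg S x := #|[set y in S | e x y]|.

Lemma sum_deg S A : \sum_(x in S) deg A x = \sum_(x in A) deg S x.
Proof.
have E S' x : deg S' x = \sum_(y in S') e x y.
  by rewrite /deg -sum1dep_card -big_mkcondr /=; apply: eq_bigl => y.
under eq_bigr do rewrite E.
rewrite exchange_big /=; apply: eq_bigr => y _; rewrite E.
by apply: eq_bigr => x _; rewrite e_sym.
Qed.

(** Take [S] maximising the degree sum minus a quadratic penalty of density 79/100, just below 4/5.
    Comparison with the whole vertex set shows that [S] is large; comparison with [S :\ x] bounds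
    the degree of [x] from below. *)
Lemma dense_core (e_irr : irreflexive e) : 0 < #|T| ->
  4 * #|T| ^ 2 <= 5 * \sum_x deg [set: T] x ->
  exists S, #|T| <= 10 * #|S| /\
    forall x, x \in S -> 158 * #|S| <= 200 * deg S x + 79.
Proof.
move=> T0 dense.
pose E S := \sum_(x in S) deg S x.
(* The offset [#|T| ^ 2] keeps the subtraction in [nat] from truncating. *)
pose F S := 100 * E S + 79 * (#|T| ^ 2 - #|S| ^ 2).
case: (@arg_maxnP _ [set: T] xpredT F isT) => S _ maxS.
have FT : #|T| ^ 2 + 79 * #|S| ^ 2 <= 100 * E S.
  have := maxS [set: T] isT; rewrite /F cardsT subnn muln0 addn0.
  have -> : E [set: T] = \sum_x deg [set: T] x by apply: eq_bigl => x; rewrite inE.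
  have : #|S| ^ 2 <= #|T| ^ 2 by rewrite leq_exp2r // max_card.
  lia.
have ES : E S <= #|S| ^ 2.
  rewrite /E -mulnn -sum_nat_const; apply: leq_sum => x _.
  by apply: subset_leq_card; apply/fintype.subsetP => y; rewrite inE => /andP[].
exists S; split.
  rewrite -(@leq_exp2r _ _ 2) // expnMn; lia.
move=> x xS.
have degD y : deg S y = deg (S :\ x) y + e y x.
  rewrite /deg (cardsD1 x) inE xS /= addnC; congr (_ + _).
  by apply: eq_card => z; rewrite !inE andbA.
have ED : E S = E (S :\ x) + 2 * deg S x.
  have -> : E S = deg S x + \sum_(y in S :\ x) deg S y by rewrite -big_setD1.
  under eq_bigr do rewrite degD.
  rewrite big_split /=.
  have -> : \sum_(y in S :\ x) e y x = deg S x.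
    rewrite degD e_irr addn0 /deg -sum1dep_card -big_mkcondr /=.
    by apply: eq_bigl => y; rewrite e_sym.
  by rewrite -/(E _); lia.
have cS := cardsD1 x S; rewrite xS in cS.
have := maxS (S :\ x) isT; rewrite /F ED cS.
have : #|S| ^ 2 <= #|T| ^ 2 by rewrite leq_exp2r // max_card.
rewrite cS; move: #|S :\ x| => s; rewrite -!mulnn => h1 h2; nia.
Qed.

Definition multipartite r t B :=
  (forall i, i < r -> #|B i| = t) /\
  forall i j x y, i < r -> j < r -> i != j -> x \in B i -> y \in B j -> e x y.

(* A vertex of [S] with fewer than [t] neighbours in some class has at most
   [(r - 1) * 40 t + t] neighbours in the union of the classes, while a class
   vertex has at least [31/40 #|S|] neighbours in [S], so vertices with at
   least [t] neighbours in every class have positive density. *)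
Lemma multipartite_grow r t S B : 0 < r <= 4 -> 0 < t ->
  160 * t * 2 ^ (r * (40 * t)) <= #|S| ->
  (forall x, x \in S -> 31 * #|S| <= 40 * deg S x) ->
  multipartite r (40 * t) B -> (forall i, i < r -> B i \subset S) ->
  exists B', multipartite r.+1 t B' /\ forall i, i < r.+1 -> B' i \subset S.
Proof.
move=> /andP[r0 r4] t0 largeS degS [cB eB] BS.
pose G := [set x in S | [forall i : 'I_r, t <= deg (B i) x]].
have upper x : x \in S ->
    \sum_(i < r) deg (B i) x <= r.-1 * (40 * t) + t + (x \in G) * (39 * t).
  move=> xS; have degB (i : 'I_r) : deg (B i) x <= 40 * t.
    rewrite -(cB i) //; apply: subset_leq_card; apply/fintype.subsetP => y.
    by rewrite inE => /andP[].
  have [xG|] := boolP (x \in G).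
    have : \sum_(i < r) deg (B i) x <= \sum_(i < r) 40 * t by apply: leq_sum.
    rewrite sum_nat_const card_ord => h; apply: leq_trans h _.
    by rewrite -{1}(prednK r0) mulSn; lia.
  rewrite inE xS /= negb_forall => /existsP[i]; rewrite -ltnNge => it.
  rewrite (bigD1 i) //=.
  have : \sum_(j < r | j != i) deg (B j) x <= \sum_(j < r | j != i) 40 * t.
    exact: leq_sum.
  rewrite sum_nat_const cardC1 card_ord => h.
  by rewrite mul0n addn0 addnC leq_add // ltnW.
have lower : r * (40 * t) * (31 * #|S|) <= 40 * \sum_(x in S) \sum_(i < r) deg (B i) x.
  rewrite exchange_big /= big_distrr /= -mulnA -[r in leqLHS]card_ord -sum_nat_const.
  apply: leq_sum => i _; rewrite sum_deg big_distrr /= -[in leqLHS](cB i) // -sum_nat_const.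
  by apply: leq_sum => y yB; apply: degS; apply: (fintype.subsetP (BS i _)).
have GS : #|S| <= 13 * #|G|.
  have total : \sum_(x in S) \sum_(i < r) deg (B i) x <=
      #|S| * (r.-1 * (40 * t) + t) + #|G| * (39 * t).
    apply: leq_trans (leq_sum _ upper) _.
    rewrite big_split /= sum_nat_const leq_add2l -big_distrl /= leq_mul2r.
    apply/orP; right; rewrite -sum1_card -big_mkcondr /=.
    rewrite (eq_bigl (mem G)) // => x; rewrite !inE.
    by case: (x \in S).
  (* Cancelling [t] in the two counts leaves [(39 - 9 * r) * #|S| <= 39 * #|G|], and the factor is
     at least 3 because [r <= 4]. *)
  have : t * (#|S| * 3) <= t * (39 * #|G|); last by rewrite leq_pmul2l //; lia.
  move: lower total; move: #|S| #|G| (\sum_(x in S) _) => s g N; clear -r0 r4.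
  have : r = 1 \/ r = 2 \/ r = 3 \/ r = 4 by lia.
  by move=> [|[|[|]]] -> /=; lia.
pose U := \bigcup_(i < r) B i.
pose f x := [set y in U | e x y].
have cU : #|U| <= r * (40 * t).
  have -> : r * (40 * t) = \sum_(i < r) #|B i|.
    by under eq_bigr => i _ do rewrite cB //; rewrite sum_nat_const card_ord.
  rewrite /U; elim/big_rec2: _ => [|i n A _ An]; first by rewrite cards0.
  by apply: leq_trans (leq_card_setU _ _) _; rewrite leq_add2l.
(* Group the vertices of [G] by their neighbourhood in the old classes. More than [t] of them share
   a trace [Y]; the new class is taken among them, and the old classes are cut down to [Y]. *)
have [Y] : exists Y, t < #|[set x in G | f x == Y]|.
  apply: (@pigeonhole_trace _ _ U).
    by move=> x _; apply/fintype.subsetP => y; rewrite inE => /andP[].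
  have : 2 ^ #|U| <= 2 ^ (r * (40 * t)) by rewrite leq_exp2l.
  have : 0 < t * 2 ^ (r * (40 * t)) by rewrite muln_gt0 t0 expn_gt0.
  move: largeS; rewrite -mulnA; move: (2 ^ _) (2 ^ _) => x y.
  nia.
set Z := [set x in G | _] => tZ.
have ZS x : x \in Z -> [/\ x \in S, forall i, i < r -> t <= deg (B i) x & f x = Y].
  rewrite !inE => /andP[/andP[xS /forallP h] /eqP xY]; split=> // i ir.
  exact: (h (Ordinal ir)).
have [z zZ] : exists z, z \in Z by apply/card_gt0P; apply: leq_trans tZ.
have YB i : i < r -> t <= #|Y :&: B i|.
  move=> ir; have [_ /(_ i ir) h fz] := ZS _ zZ; apply: leq_trans h _.
  apply: subset_leq_card; apply/fintype.subsetP => y; rewrite !inE -fz !inE.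
  move=> /andP[yB ->]; rewrite yB !andbT; apply/bigcupP.
  by exists (Ordinal ir).
exists (fun i => if i < r then select t (Y :&: B i) else select t Z).
have selB i x : x \in select t (Y :&: B i) -> x \in Y /\ x \in B i.
  by move/(fintype.subsetP (select_sub _ _)); rewrite inE => /andP[].
have selZ x : x \in select t Z -> x \in Z by move/(fintype.subsetP (select_sub _ _)).
have ZY x y : x \in Z -> y \in Y -> e x y.
  by move=> /ZS[_ _ <-]; rewrite inE => /andP[].
split; first split.
- by move=> i _; case: ifP => ir; rewrite card_select // ?YB // ltnW.
- move=> i j x y; rewrite !ltnS => ir jr ij; case: ifP => ir'; case: ifP => jr'.
  + by move=> /selB[_ xB] /selB[_ yB]; apply: (eB i j).
  + by move=> /selB[xY _] /selZ yZ; rewrite e_sym ZY.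
  + by move=> /selZ xZ /selB[yY _]; rewrite ZY.
  + by move: ij; rewrite neq_ltn; lia.
- move=> i _; case: ifP => ir; apply/fintype.subsetP => x.
    by move=> /selB[_]; apply: (fintype.subsetP (BS i ir)).
  by move=> /selZ /ZS[].
Qed.

End DenseGraph.

(** * Complete five-partite subgraphs and monochromatic pairs *)

Section BlowUp.
Local Open Scope nat_scope.

(** Start from one class of [40 ^ 4 * t] vertices of the dense core. Each of four growth steps adds
    a class and divides the class size by 40. *)
Lemma multipartite_exists t : 0 < t -> exists N, forall (T : finType) (e : rel T),
  symmetric e -> irreflexive e -> N <= #|T| -> 4 * #|T| ^ 2 <= 5 * \sum_x deg e [set: T] x ->
  exists B, multipartite e 5 t B.
Proof.
move=> t0; pose n k := 40 ^ k * t.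
(* What [multipartite_grow] demands for [r = 4] and [t = n 3], an upper bound for its demand at
   every step. *)
pose b := 160 * n 3 * 2 ^ (4 * (40 * n 3)).
(* The factor 10 pays for passing to the core. For [s >= 27] one has [158 * s - 79 >= 155 * s],
   which turns the degree bound of the core into the ratio 31/40. *)
exists (10 * (b + n 4 + 27)) => T e e_sym e_irr NT dense.
have T0 : 0 < #|T| by apply: leq_trans NT; rewrite muln_gt0 addn_gt0 orbT.
have [S [TS degS]] := dense_core e_sym e_irr T0 dense.
have {TS}NS : b + n 4 + 27 <= #|S|.
  by rewrite -(@leq_pmul2l 10) //; apply: leq_trans NT TS.
have [bS n4S S27] : [/\ b <= #|S|, n 4 <= #|S| & 27 <= #|S|].
  by split; apply: leq_trans NS; rewrite ?leq_addl // -addnA ?leq_addr // addnCA leq_addr.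
have degS31 x : x \in S -> 31 * #|S| <= 40 * deg e S x.
  by move=> /degS; move: S27; clear; lia.
have n_gt0 k : 0 < n k by rewrite muln_gt0 expn_gt0.
have classes r : 0 < r <= 5 -> exists B,
    multipartite e r (n (5 - r)) B /\ forall i, i < r -> B i \subset S.
  case: r => [//|r]; elim: r => [|r IHr] r5.
    rewrite (_ : 5 - 1 = 4) //.
    exists (fun=> select (n 4) S); split; last by move=> i _; apply: select_sub.
    split; first by move=> i _; rewrite card_select.
    by move=> [|i] [|j].
  have r5' : 0 < r.+1 <= 5 by move: r5; lia.
  have [B []] := IHr r5'.
  have -> : n (5 - r.+1) = 40 * n (5 - r.+2).
    by rewrite /n mulnA -expnS; congr (40 ^ _ * _); move: r5; lia.
  have r4 : 0 < r.+1 <= 4 by move: r5; lia.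
  apply: (multipartite_grow e_sym r4 (n_gt0 _) _ degS31); apply: leq_trans bS.
  have nk : n (5 - r.+2) <= n 3 by rewrite leq_mul2r leq_pexp2l ?orbT //; lia.
  have nk' m : m * n (5 - r.+2) <= m * n 3 by rewrite leq_mul2l nk orbT.
  apply: leq_mul => //; rewrite leq_pexp2l //; apply: leq_mul => //.
have [B [eB _]] := classes 5 isT; exists B.
by rewrite /n subnn mul1n in eB.
Qed.

(** A class with more vertices than there are colours contains two of the same colour. The colours
    will be cells of a grid, so that equal colour means closeness. *)
Lemma monochromatic_blow_up (C : finType) : exists N,
    forall (T : finType) (e : rel T) (c : T -> C),
  symmetric e -> irreflexive e -> N <= #|T| -> 4 * #|T| ^ 2 <= 5 * \sum_x deg e [set: T] x ->
  exists f : 'I_5 -> bool -> T,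
    [/\ forall i, f i true != f i false, forall i, c (f i true) = c (f i false)
      & forall i j b b', i != j -> e (f i b) (f j b')].
Proof.
have [N hN] := @multipartite_exists #|C|.+1 isT; exists N => T e c e_sym e_irr NT dense.
have [B [cB eB]] := hN T e e_sym e_irr NT dense.
have pair (i : 'I_5) : exists p : T * T,
    [/\ p.1 \in B i, p.2 \in B i, p.1 != p.2 & c p.1 = c p.2].
  have : ~~ dinjectiveb c (mem (B i)).
    apply/negP => /dinjectiveP inj.
    have : #|B i| <= #|C| by rewrite -(card_in_imset inj) max_card.
    by rewrite cB // ltnn.
  move=> /dinjectivePn[x xB [y]]; rewrite !inE => /andP[yx yB] xy.
  by exists (x, y); split; rewrite // eq_sym.
have [p hp] := choice pair.
exists (fun i b => if b then (p i).1 else (p i).2).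
split=> [i|i|i j b b' ij]; try by have [] := hp i.
have [p1 p2 _ _] := hp i; have [q1 q2 _ _] := hp j.
by apply: (eB i j); rewrite ?ltn_ord //; [case: b|case: b'].
Qed.

End BlowUp.

Local Open Scope classical_set_scope.
Local Open Scope ring_scope.

(** * Five lines in space *)

Section Tie.
Variable R : realType.

Definition spread (hi lo x y : R) := [/\ lo < hi, lo <= x <= hi & lo <= y <= hi].

(* For directions with [v1 + v2 + v3 + v4 = 0], the six normals [vi x vj] are
   [A = v1 x v2], [B = v1 x v3], [- A - B], [C = v2 x v3], [A - C] and [B + C];
   [A1] is the value of [A] at the first point, and so on, and the booleans
   tell which of the two points is on the upper side of the slab.  The third
   alternative says that, seen along [v1], the fourth line is the middle one of
   the other three. *)
Lemma four_lines_tie (s12 s13 s14 s23 s24 s34 : bool)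
    (A1 A2 A3 A4 B1 B2 B3 B4 C1 C2 C3 C4 : R) :
  (if s12 then spread A1 A2 A3 A4 else spread A2 A1 A3 A4) ->
  (if s13 then spread B1 B3 B2 B4 else spread B3 B1 B2 B4) ->
  (if s14 then spread (- A1 - B1) (- A4 - B4) (- A2 - B2) (- A3 - B3)
   else spread (- A4 - B4) (- A1 - B1) (- A2 - B2) (- A3 - B3)) ->
  (if s23 then spread C2 C3 C1 C4 else spread C3 C2 C1 C4) ->
  (if s24 then spread (A2 - C2) (A4 - C4) (A1 - C1) (A3 - C3)
   else spread (A4 - C4) (A2 - C2) (A1 - C1) (A3 - C3)) ->
  (if s34 then spread (B3 + C3) (B4 + C4) (B1 + C1) (B2 + C2)
   else spread (B4 + C4) (B3 + C3) (B1 + C1) (B2 + C2)) ->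
  [\/ C1 = C2, C1 = C3 | s12 = s13 /\ s14 = ~~ s12].
Proof.
(* Two of the eight patterns of [s12], [s13], [s14] are the third alternative. Each of the 48
   remaining sign patterns is infeasible or forces a tie, by linear arithmetic. *)
case: s12; case: s13; case: s14; try (by move=> *; apply: Or33);
case: s23; case: s24; case: s34 => -[? /andP[? ?] /andP[? ?]] [? /andP[? ?] /andP[? ?]]
 [? /andP[? ?] /andP[? ?]] [? /andP[? ?] /andP[? ?]] [? /andP[? ?] /andP[? ?]]
 [? /andP[? ?] /andP[? ?]]; first [apply: Or31; lra | apply: Or32; lra | exfalso; lra].
Qed.

End Tie.

(** * Vector algebra in dimension three *)

Section Space.
Variable R : realType.
Implicit Types (u v w x y z : 'rV[R]_3) (c : R).

Lemma row3P u v :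
  [/\ u 0 0 = v 0 0, u 0 1 = v 0 1 & u 0 2%:R = v 0 2%:R] -> u = v.
Proof.
move=> [h0 h1 h2]; apply/rowP => -[[|[|[|//]]] k].
- by rewrite (_ : Ordinal k = 0) //; apply/val_inj.
- by rewrite (_ : Ordinal k = 1) //; apply/val_inj.
- by rewrite (_ : Ordinal k = 2%:R) //; apply/val_inj.
Qed.

Lemma dot3E u x :
  dot u x = u 0 0 * x 0 0 + u 0 1 * x 0 1 + u 0 2%:R * x 0 2%:R.
Proof.
rewrite /dot !big_ord_recr big_ord0 /= add0r.
by congr (u 0 _ * x 0 _ + u 0 _ * x 0 _ + u 0 _ * x 0 _); apply/val_inj.
Qed.

Definition cross u v : 'rV[R]_3 :=
  \row_k [:: u 0 1 * v 0 2%:R - u 0 2%:R * v 0 1;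
             u 0 2%:R * v 0 0 - u 0 0 * v 0 2%:R;
             u 0 0 * v 0 1 - u 0 1 * v 0 0]`_k.

Lemma cross0E u v : cross u v 0 0 = u 0 1 * v 0 2%:R - u 0 2%:R * v 0 1.
Proof. by rewrite mxE. Qed.
Lemma cross1E u v : cross u v 0 1 = u 0 2%:R * v 0 0 - u 0 0 * v 0 2%:R.
Proof. by rewrite mxE. Qed.
Lemma cross2E u v : cross u v 0 2%:R = u 0 0 * v 0 1 - u 0 1 * v 0 0.
Proof. by rewrite mxE. Qed.

Definition crossE := (cross0E, cross1E, cross2E).
Definition vecE := (dot3E, crossE, mxE).

Lemma dotD u x y : dot u (x + y) = dot u x + dot u y.
Proof. by rewrite !vecE; lra. Qed.
Lemma dotB u x y : dot u (x - y) = dot u x - dot u y.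
Proof. by rewrite !vecE; lra. Qed.
Lemma dotZ u c x : dot u (c *: x) = c * dot u x.
Proof. by rewrite !vecE; lra. Qed.
Lemma dotDl u v x : dot (u + v) x = dot u x + dot v x.
Proof. by rewrite !vecE; lra. Qed.
Lemma dotNl u x : dot (- u) x = - dot u x.
Proof. by rewrite !vecE; lra. Qed.
Lemma dotZl c u x : dot (c *: u) x = c * dot u x.
Proof. by rewrite !vecE; lra. Qed.

Definition det u v w := dot (cross u v) w.

Lemma sqr_dot_eq0 u : dot u u = 0 -> u = 0.
Proof.
rewrite dot3E -!expr2 => h.
have h0 := sqr_ge0 (u 0 0); have h1 := sqr_ge0 (u 0 1).
have h2 := sqr_ge0 (u 0 2%:R).
apply: row3P; rewrite !mxE; split; apply/eqP; rewrite -sqrf_eq0; apply/eqP; lra.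
Qed.

Lemma cross_eq0 u w : w != 0 -> cross u w = 0 -> exists c, u = c *: w.
Proof.
move=> w0 h.
have ww : dot w w != 0 by apply: contra w0 => /eqP /sqr_dot_eq0 ->.
(* The coefficient of the orthogonal projection of [u] onto [w]. *)
exists (dot u w / dot w w).
have e0 := cross0E u w; have e1 := cross1E u w; have e2 := cross2E u w.
rewrite h !mxE in e0 e1 e2.
suff e k : dot w w * u 0 k = dot u w * w 0 k.
  by apply/rowP => k; rewrite !mxE mulrAC -e mulrAC mulfV // mul1r.
suff : [/\ dot w w * u 0 0 = dot u w * w 0 0, dot w w * u 0 1 = dot u w * w 0 1
   & dot w w * u 0 2%:R = dot u w * w 0 2%:R].
  move=> [k0 k1 k2]; have := @row3P (dot w w *: u) (dot u w *: w).
  by rewrite !mxE => /(_ (And3 k0 k1 k2)) /rowP /(_ k); rewrite !mxE.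
rewrite !dot3E; split; apply/eqP; rewrite -subr_eq0; apply/eqP.
- transitivity (w 0 2%:R * - (u 0 2%:R * w 0 0 - u 0 0 * w 0 2%:R)
     + w 0 1 * (u 0 0 * w 0 1 - u 0 1 * w 0 0)); first by lra.
  by rewrite -e1 -e2; lra.
- transitivity (w 0 2%:R * (u 0 1 * w 0 2%:R - u 0 2%:R * w 0 1)
     - w 0 0 * (u 0 0 * w 0 1 - u 0 1 * w 0 0)); first by lra.
  by rewrite -e0 -e2; lra.
- transitivity (w 0 0 * (u 0 2%:R * w 0 0 - u 0 0 * w 0 2%:R)
     - w 0 1 * (u 0 1 * w 0 2%:R - u 0 2%:R * w 0 1)); first by lra.
  by rewrite -e0 -e1; lra.
Qed.

Lemma cross_crossr u v w : cross u (cross v w) = dot u w *: v - dot u v *: w.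
Proof. by apply: row3P; rewrite !vecE; split; lra. Qed.

Lemma cross_crossl u v w : cross (cross u v) (cross u w) = det u v w *: u.
Proof. by rewrite /det; apply: row3P; rewrite !vecE; split; lra. Qed.

Lemma crossC u v : cross v u = - cross u v.
Proof. by apply: row3P; rewrite !vecE; split; lra. Qed.

Lemma crossZl c u v : cross (c *: u) v = c *: cross u v.
Proof. by apply: row3P; rewrite !vecE; split; lra. Qed.

Lemma crossZr c u v : cross u (c *: v) = c *: cross u v.
Proof. by apply: row3P; rewrite !vecE; split; lra. Qed.

Lemma crossBr u v w : cross u (v - w) = cross u v - cross u w.
Proof. by apply: row3P; rewrite !vecE; split; lra. Qed.

Lemma dotC u v : dot u v = dot v u.
Proof. by rewrite !vecE; lra. Qed.

Lemma detC u v w : det u w v = - det u v w.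
Proof. by rewrite /det !vecE; lra. Qed.

Lemma crossvv u : cross u u = 0.
Proof. by apply: row3P; rewrite !vecE; split; lra. Qed.

Lemma dot_cross_l u v : dot (cross u v) u = 0.
Proof. by rewrite !vecE; lra. Qed.

Lemma dot_cross_r u v : dot (cross u v) v = 0.
Proof. by rewrite !vecE; lra. Qed.

Lemma perp_cross u v w : dot u v = 0 -> dot u w = 0 -> cross v w != 0 ->
  exists c, u = c *: cross v w.
Proof.
by move=> uv uw n0; apply: cross_eq0 => //; rewrite cross_crossr uv uw !scale0r subr0.
Qed.

Lemma cross_eq0_trans u v w :
  v != 0 -> w != 0 -> cross u v = 0 -> cross v w = 0 -> cross u w = 0.
Proof.
move=> v0 w0 /(cross_eq0 v0)[c ->] /(cross_eq0 w0)[d ->].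
by rewrite !crossZl crossvv !scaler0.
Qed.

Lemma cramer3 u v w x :
  det u v w *: x = det x v w *: u + det u x w *: v + det u v x *: w.
Proof. by rewrite /det; apply: row3P; rewrite !vecE; split; lra. Qed.

End Space.

(** * Slabs of pairs of lines; parallel and coplanar directions *)

Section Lines.
Variables (R : realType) (I : eqType) (a v : I -> 'rV[R]_3).
Variable u : I -> I -> 'rV[R]_3.
Implicit Types (i j k l : I) (f : I -> R).

Definition extremal f i j := (forall k, f j <= f k <= f i) /\ f j < f i.

(** Each of [i], [j], [k] would take the maximal or the minimal value, and three values cannot be
    pairwise different. *)
Lemma extremal_triple f i j k : extremal f i j \/ extremal f j i ->
  extremal f i k \/ extremal f k i -> extremal f j k \/ extremal f k j -> False.
Proof.
move=> [[ij ij']|[ij ij']] [[ik ik']|[ik ik']] [[jk jk']|[jk jk']];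
by have := ij k; have := ik j; have := jk i; lra.
Qed.

Hypothesis v_neq0 : forall i, v i != 0.
Hypothesis u_perp : forall i j, i != j -> dot (u i j) (v i) = 0.
Hypothesis u_perp' : forall i j, i != j -> dot (u i j) (v j) = 0.
Hypothesis u_ext : forall i j, i != j -> extremal (fun k => dot (u i j) (a k)) i j.

(** Orthogonality to two independent directions determines [u i j] up to a factor. The sign of the
    factor decides which point is on the upper side. *)
Lemma normal_extremal_sign (n : 'rV[R]_3) i j : i != j ->
  dot n (v i) = 0 -> dot n (v j) = 0 -> cross (v i) (v j) != 0 -> n != 0 ->
  exists s : bool,
    (if s then extremal (fun k => dot n (a k)) i j
     else extremal (fun k => dot n (a k)) j i) /\
    exists2 c, 0 < c & u i j = (if s then c else - c) *: n.
Proof.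
move=> ij ni nj w0 n0.
have [d nE] := perp_cross ni nj w0.
have [c uE] := perp_cross (u_perp ij) (u_perp' ij) w0.
have d0 : d != 0 by apply: contra n0 => /eqP d0; rewrite nE d0 scale0r.
have {}uE : u i j = (c / d) *: n by rewrite nE scalerA mulfVK.
have [ule ult] := u_ext ij; move: ule ult; rewrite uE !dotZl => ule ult.
have [e0|e0|e0] := ltrgt0P (c / d).
- exists true; split; last by exists (c / d).
  split; first by move=> k; have := ule k; rewrite !dotZl !ler_pM2l.
  by rewrite ltr_pM2l in ult.
- exists false; split; last by exists (- (c / d)); rewrite ?oppr_gt0 ?opprK.
  split; first by move=> k; have := ule k; rewrite !dotZl !ler_nM2l // andbC.
  by rewrite ltr_nM2l in ult.
- by rewrite e0 !mul0r ltxx in ult.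
Qed.

Lemma normal_extremal (n : 'rV[R]_3) i j : i != j ->
  dot n (v i) = 0 -> dot n (v j) = 0 -> cross (v i) (v j) != 0 -> n != 0 ->
  extremal (fun k => dot n (a k)) i j \/ extremal (fun k => dot n (a k)) j i.
Proof.
by move=> ij ni nj w0 n0; have [[] []] := normal_extremal_sign ij ni nj w0 n0; [left|right].
Qed.

Lemma displacement_not_parallel i j c : i != j -> a j - a i = c *: v i -> False.
Proof.
move=> ij e; have [_] := u_ext ij; rewrite ltNge => /negP; apply.
by rewrite -subr_le0 -dotB -opprB e -scaleNr dotZ u_perp // mulr0.
Qed.

(** If the three directions were coplanar, their common normal would be extremal for all three
    pairs, against [extremal_triple]. *)
Lemma coplanar_directions i j k : i != j -> i != k -> j != k ->
  cross (v i) (v j) != 0 -> cross (v i) (v k) != 0 -> cross (v j) (v k) != 0 ->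
  det (v i) (v j) (v k) != 0.
Proof.
move=> ij ik jk wij wik wjk; apply/negP => /eqP d0.
have ni := dot_cross_l (v i) (v j); have nj := dot_cross_r (v i) (v j).
apply: (@extremal_triple (fun l => dot (cross (v i) (v j)) (a l)) i j k);
  by apply: normal_extremal.
Qed.

(** The common normal of the parallel directions and [v m] has [a i] and [a j] both at the extreme
    opposite to [a m]. *)
Lemma parallel_level i j m : i != m -> j != m ->
  cross (v i) (v j) = 0 -> cross (v i) (v m) != 0 ->
  dot (a j - a i) (cross (v i) (v m)) = 0.
Proof.
move=> im jm pij nim.
have njm : cross (v j) (v m) != 0.
  apply: contra nim => /eqP e; apply/eqP.
  exact: (cross_eq0_trans (v_neq0 j) (v_neq0 m) pij e).
have nj : dot (cross (v i) (v m)) (v j) = 0.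
  have [c ->] : exists c, v j = c *: v i.
    by apply: cross_eq0 => //; rewrite crossC pij oppr0.
  by rewrite dotZ dot_cross_l mulr0.
have := normal_extremal im (dot_cross_l _ _) (dot_cross_r _ _) nim nim.
have := normal_extremal jm nj (dot_cross_r _ _) njm nim.
rewrite dotC dotB => h1 h2; apply/eqP; rewrite subr_eq0; apply/eqP.
by case: h1 => -[h1 h1']; case: h2 => -[h2 h2'];
  have := h1 i; have := h2 j; lra.
Qed.

(** Otherwise [a j - a i] is orthogonal to two independent normals to [v i], hence parallel to
    [v i], although [u i j] separates the two points. *)
Lemma two_parallel i j k l : i != j -> k != l -> i != k -> i != l -> j != k -> j != l ->
  cross (v i) (v j) = 0 -> cross (v i) (v k) != 0 -> cross (v i) (v l) != 0 ->
  cross (v k) (v l) = 0.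
Proof.
move=> ij kl ik il jk jl pij nik nil; apply/eqP; apply/negPn/negP => nkl.
have n0 : cross (cross (v i) (v k)) (cross (v i) (v l)) != 0.
  rewrite cross_crossl scaler_eq0 negb_or v_neq0 andbT.
  exact: coplanar_directions.
have [c] := perp_cross (parallel_level ik jk pij nik) (parallel_level il jl pij nil) n0.
rewrite cross_crossl scalerA => e.
exact: (displacement_not_parallel ij e).
Qed.

(* Modulo the common direction, three coplanar lines become three points of a
   line. *)
Lemma parallel_triple_not_coplanar i j k : i != j -> i != k -> j != k ->
  cross (v i) (v j) = 0 -> cross (v i) (v k) = 0 ->
  det (v i) (a j - a i) (a k - a i) != 0.
Proof.
move=> ij ik jk pij pik; apply/negP => /eqP d0.
have perp w m : cross (v i) (v m) = 0 -> dot w (v m) = 0 -> dot w (v i) = 0.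
  by move=> /(cross_eq0 (v_neq0 m))[c ->]; rewrite dotZ => ->; rewrite mulr0.
have n0 : cross (v i) (a j - a i) != 0.
  apply/negP => /eqP h.
  have [c e] : exists c, a j - a i = c *: v i.
    by apply: cross_eq0 => //; rewrite crossC h oppr0.
  exact: (displacement_not_parallel ij e).
(* Along [v i] the points [a i], [a j], [a k] project to positions 0, 1, [c] of a line. The minimum
   of [u i j] at [j] gives [c <= 1], that of [u i k] at [k] gives [1 <= c], and [u j k] excludes
   equality. *)
have [c eC] : exists c, cross (v i) (a k - a i) = c *: cross (v i) (a j - a i).
  by apply: cross_eq0 => //; rewrite cross_crossl detC d0 oppr0 scale0r.
have uc w : dot w (v i) = 0 ->
    dot w (a k) - dot w (a i) = c * (dot w (a j) - dot w (a i)).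
  move=> wi; rewrite -!dotB -dotZ; apply/eqP; rewrite -subr_eq0 -dotB.
  have [d ->] : exists d, (a k - a i) - c *: (a j - a i) = d *: v i.
    by apply: cross_eq0 => //; rewrite crossC crossBr eC crossZr subrr oppr0.
  by rewrite dotZ wi mulr0.
have [/(_ k) /andP[h1 _] h1'] := u_ext ij; have e1 := uc _ (u_perp ij).
have [/(_ j) /andP[h2 h2''] h2'] := u_ext ik; have e2 := uc _ (u_perp ik).
have [_ h3'] := u_ext jk; have e3 := uc _ (perp _ _ pij (u_perp jk)).
have c1 : c <= 1.
  rewrite -(ler_nM2r (_ : dot (u i j) (a j) - dot (u i j) (a i) < 0)); lra.
have c2 : 1 <= c.
  have h : dot (u i k) (a j) - dot (u i k) (a i) < 0.
    rewrite lt_neqAle subr_le0 h2'' andbT; apply/eqP => h.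
    by move: h2'; rewrite -subr_lt0 e2 h mulr0 ltxx.
  by rewrite -(ler_nM2r h); lra.
have c3 : c = 1 by lra.
by move: e3 h3'; rewrite c3 mul1r => /addIr ->; rewrite ltxx.
Qed.

(** By [parallel_level] the normal [cross (v i) (v m)] is orthogonal to [a j - a i] and [a k - a i],
    as well as to [v i]. These three vectors are independent, so the normal vanishes. *)
Lemma three_parallel i j k m : i != j -> i != k -> j != k ->
  i != m -> j != m -> k != m ->
  cross (v i) (v j) = 0 -> cross (v i) (v k) = 0 -> cross (v i) (v m) = 0.
Proof.
move=> ij ik jk im jm km pij pik; apply/eqP/negPn/negP => nim.
have := parallel_triple_not_coplanar ij ik jk pij pik; apply/negP/negPn.
have := parallel_level im km pik nim; have := parallel_level im jm pij nim.
set n := cross _ (v m) in nim *; rewrite dotC => nj; rewrite dotC => nk.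
have := congr1 (dot n) (cramer3 (v i) (a j - a i) (a k - a i) n).
rewrite !dotD !dotZ nj nk dot_cross_l !mulr0 !addr0 => /eqP.
by rewrite mulf_eq0 => /orP[//|/eqP/sqr_dot_eq0 n0]; rewrite n0 eqxx in nim.
Qed.

(** Four pairwise antipodal points of a plane are the vertices of a parallelogram. Here the plane is
    the quotient by a common direction and is seen through the functionals; [p], [q], [r] are the
    affine coordinates of the fourth point. *)
Lemma parallelogram i j k l (p q r : R) :
  i != j -> i != k -> i != l -> j != k -> j != l -> k != l -> p + q + r = 1 ->
  (forall s t, s != t -> dot (u s t) (a l) =
     p * dot (u s t) (a i) + q * dot (u s t) (a j) + r * dot (u s t) (a k)) ->
  [\/ [/\ p = 1, q = 1 & r = -1], [/\ p = 1, q = -1 & r = 1]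
    | [/\ p = -1, q = 1 & r = 1]].
Proof.
(* [far] and [apex] test the functional that separates [x] from the new point [m], and [near] the
   one that separates [x] from [z]; [base] combines [far] and [near]. *)
have far x y z m (b c d : R) : x != m -> b + c + d = 1 -> 0 <= c ->
    (forall s t, s != t -> dot (u s t) (a m) =
     b * dot (u s t) (a x) + c * dot (u s t) (a y) + d * dot (u s t) (a z)) ->
    b <= 0 \/ b <= - d.
  move=> xm bcd c0 e; have := e _ _ xm; have [h h'] := u_ext xm.
  move: (h y) (h z) h' => /andP[]; set X := dot _ (a x); set M := dot _ (a m).
  set Y := dot _ (a y); set Z := dot _ (a z) => yM yX /andP[zM zX] xM eM.
  have XM : 0 < X - M by lra.
  have cY : 0 <= c * (Y - M) by apply: mulr_ge0; lra.
  have [d0|d0] := leP 0 d; [left|right]; rewrite -(ler_pM2r XM).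
    have : 0 <= d * (Z - M) by apply: mulr_ge0; lra.
    have : M = (b + c + d) * M by rewrite bcd mul1r.
    by clear -eM cY; lra.
  have : 0 <= - d * (X - Z) by apply: mulr_ge0; lra.
  have : M = (b + c + d) * M by rewrite bcd mul1r.
  by clear -eM cY; lra.
have near x y z m (b c d : R) : x != z -> b + c + d = 1 -> 0 <= c ->
    (forall s t, s != t -> dot (u s t) (a m) =
     b * dot (u s t) (a x) + c * dot (u s t) (a y) + d * dot (u s t) (a z)) ->
    b <= 1.
  move=> xz bcd c0 e; have := e _ _ xz; have [h h'] := u_ext xz.
  move: (h y) (h m) h' => /andP[]; set X := dot _ (a x); set M := dot _ (a m).
  set Y := dot _ (a y); set Z := dot _ (a z) => yZ yX /andP[mZ mX] zX eM.
  have XZ : 0 < X - Z by lra.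
  have cY : 0 <= c * (Y - Z) by apply: mulr_ge0; lra.
  rewrite -(ler_pM2r XZ); have : Z = (b + c + d) * Z by rewrite bcd mul1r.
  by clear -eM cY mX; lra.
have apex x y z m (b c d : R) : x != m -> b + c + d = 1 -> c < 0 -> d < 0 ->
    (forall s t, s != t -> dot (u s t) (a m) =
     b * dot (u s t) (a x) + c * dot (u s t) (a y) + d * dot (u s t) (a z)) ->
    False.
  move=> xm bcd c0 d0 e; have := e _ _ xm; have [h h'] := u_ext xm.
  move: (h y) (h z) h' => /andP[]; set X := dot _ (a x); set M := dot _ (a m).
  set Y := dot _ (a y); set Z := dot _ (a z) => yM yX /andP[zM zX] xM eM.
  have cY : 0 <= - c * (X - Y) by apply: mulr_ge0; lra.
  have dZ : 0 <= - d * (X - Z) by apply: mulr_ge0; lra.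
  have eX : X = (b + c + d) * X by rewrite bcd mul1r.
  have : X <= M by clear -eM cY dZ eX; lra.
  by rewrite leNgt xM.
have base x y z m (b c d : R) : x != z -> y != z -> x != m -> y != m ->
    b + c + d = 1 -> 0 <= b -> 0 <= c -> d < 0 ->
    (forall s t, s != t -> dot (u s t) (a m) =
     b * dot (u s t) (a x) + c * dot (u s t) (a y) + d * dot (u s t) (a z)) ->
    [/\ b = 1, c = 1 & d = -1].
  move=> xz yz xm ym bcd b0 c0 d0 e.
  have cbd : c + b + d = 1 by lra.
  have e' s t : s != t -> dot (u s t) (a m) =
     c * dot (u s t) (a y) + b * dot (u s t) (a x) + d * dot (u s t) (a z).
    by move=> st; rewrite e //; lra.
  have b1 := near _ _ _ _ _ _ _ xz bcd c0 e.
  have c1 := near _ _ _ _ _ _ _ yz cbd b0 e'.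
  have := far _ _ _ _ _ _ _ xm bcd c0 e; have := far _ _ _ _ _ _ _ ym cbd b0 e'.
  by move=> [h|h] [h'|h']; split; lra.
move=> ij ik il jk jl kl pqr e.
have swapl (b c d : R) x y z : (forall s t, s != t -> dot (u s t) (a l) =
     b * dot (u s t) (a x) + c * dot (u s t) (a y) + d * dot (u s t) (a z)) ->
   forall s t, s != t -> dot (u s t) (a l) =
     c * dot (u s t) (a y) + b * dot (u s t) (a x) + d * dot (u s t) (a z).
  by move=> h s t st; rewrite h //; lra.
have swapr (b c d : R) x y z : (forall s t, s != t -> dot (u s t) (a l) =
     b * dot (u s t) (a x) + c * dot (u s t) (a y) + d * dot (u s t) (a z)) ->
   forall s t, s != t -> dot (u s t) (a l) =
     b * dot (u s t) (a x) + d * dot (u s t) (a z) + c * dot (u s t) (a y).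
  by move=> h s t st; rewrite h //; lra.
have eq_rqp : r + q + p = 1 by lra.
have eq_qrp : q + r + p = 1 by lra.
have eq_prq : p + r + q = 1 by lra.
have eq_qpr : q + p + r = 1 by lra.
have e_prq := swapr _ _ _ _ _ _ e; have e_qpr := swapl _ _ _ _ _ _ e.
have e_qrp := swapr _ _ _ _ _ _ e_qpr; have e_rqp := swapl _ _ _ _ _ _ e_qrp.
have kj : k != j by rewrite eq_sym.
have ji : j != i by rewrite eq_sym.
have ki : k != i by rewrite eq_sym.
(* No negative coordinate contradicts [far], one gives a parallelogram by [base], two contradict
   [apex], and three contradict the sum 1. *)
have [p0|p0] := leP 0 p; have [q0|q0] := leP 0 q; have [r0|r0] := leP 0 r.
- have := far _ _ _ _ _ _ _ il pqr q0 e; have := far _ _ _ _ _ _ _ jl eq_qpr p0 e_qpr.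
  have := far _ _ _ _ _ _ _ kl eq_rqp q0 e_rqp.
  by move=> [h1|h1] [h2|h2] [h3|h3]; exfalso; clear -p0 q0 r0 pqr h1 h2 h3; lra.
- by apply: Or31; apply: (base _ _ _ _ _ _ _ ik jk il jl pqr).
- by apply: Or32; have [] := base _ _ _ _ _ _ _ ij kj il kl eq_prq p0 r0 q0 e_prq.
- by case: (apex _ _ _ _ _ _ _ il pqr q0 r0 e).
- by apply: Or33; have [] := base _ _ _ _ _ _ _ ji ki jl kl eq_qrp q0 r0 p0 e_qrp.
- by case: (apex _ _ _ _ _ _ _ jl eq_qpr p0 r0 e_qpr).
- by case: (apex _ _ _ _ _ _ _ kl eq_rqp q0 p0 e_rqp).
- by exfalso; clear -p0 q0 r0 pqr; lra.
Qed.

(** Modulo the common direction, [a l] and [a m] both complete the triangle of [a i], [a j], [a k]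
    to a parallelogram. Either they coincide, against [u l m], or some vertex of the triangle is
    their midpoint, against the functional that separates [a l] from that vertex. *)
Lemma five_not_parallel i j k l m :
  i != j -> i != k -> i != l -> j != k -> j != l -> k != l ->
  i != m -> j != m -> k != m -> l != m ->
  (forall s t, cross (v s) (v t) = 0) -> False.
Proof.
move=> ij ik il jk jl kl im jm km lm par.
set D := det (v i) (a j - a i) (a k - a i).
have D0 : D != 0 by apply: parallel_triple_not_coplanar.
have coord x : exists p q r : R, p + q + r = 1 /\
    forall s t, s != t -> dot (u s t) (a x) =
     p * dot (u s t) (a i) + q * dot (u s t) (a j) + r * dot (u s t) (a k).
  pose q := det (v i) (a x - a i) (a k - a i) / D.
  pose r := det (v i) (a j - a i) (a x - a i) / D.
  exists (1 - q - r), q, r; split; first by lra.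
  move=> s t st.
  have si : dot (u s t) (v i) = 0.
    have [c ->] := cross_eq0 (v_neq0 s) (par i s).
    by rewrite dotZ u_perp ?mulr0.
  have := congr1 (dot (u s t)) (cramer3 (v i) (a j - a i) (a k - a i) (a x - a i)).
  rewrite !dotD !dotZ si mulr0 add0r !dotB -/D => /(canRL (mulKf D0)).
  rewrite mulrDr !mulrA ![D^-1 * _]mulrC -/q -/r => h.
  by clear -h; lra.
have [p [q [r [pqr e]]]] := coord l; have [p' [q' [r' [pqr' e']]]] := coord m.
have pl := parallelogram ij ik il jk jl kl pqr e.
have pm := parallelogram ij ik im jk jm km pqr' e'.
have [li [lj lk]] : [/\ l != i, l != j & l != k].
  by rewrite ![l == _]eq_sym.
have [hi _] := u_ext li; have [hj _] := u_ext lj; have [hk _] := u_ext lk.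
have [_ si] := u_ext li; have [_ sj] := u_ext lj; have [_ sk] := u_ext lk.
have [_ sm] := u_ext lm.
move: (hi m) (hj m) (hk m) => /andP[+ _] /andP[+ _] /andP[+ _].
move: sm si sj sk; rewrite !e ?e' //; clear -pl pm.
by case: pl => -[-> -> ->]; case: pm => -[-> -> ->] *; lra.
Qed.

End Lines.

(** * Five lines with pairwise independent directions *)

Section GeneralPosition.
Variables (R : realType) (I : eqType) (a v : I -> 'rV[R]_3).
Variable u : I -> I -> 'rV[R]_3.
Implicit Types (i j k l m x y z w : I).
Hypothesis v_neq0 : forall i, v i != 0.
Hypothesis u_perp : forall i j, i != j -> dot (u i j) (v i) = 0.
Hypothesis u_perp' : forall i j, i != j -> dot (u i j) (v j) = 0.
Hypothesis u_ext : forall i j, i != j -> extremal (fun k => dot (u i j) (a k)) i j.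
Hypothesis not_parallel : forall i j, i != j -> cross (v i) (v j) != 0.

(** The plane in question contains the line of [a x] and is parallel to [v y]: it is one of the two
    boundary planes of the slab of [x] and [y], and [tied] allows either of them. *)
Let on x y i := dot (cross (v x) (v y)) (a i - a x) = 0.
Let tied x y i := on x y i \/ on y x i.
(** The order of the lines as seen along [v i], expressed by their normals. *)
Let between i x y z :=
  exists c d : R, [/\ 0 < c, 0 < d & u i z = c *: u i x + d *: u i y].

Let indep i j k : i != j -> i != k -> j != k -> det (v i) (v j) (v k) != 0.
Proof.
move=> ij ik jk.
by apply: (coplanar_directions u_perp u_perp' u_ext ij ik jk); apply: not_parallel.
Qed.

Lemma on_unique x y z i : x != y -> x != z -> y != z -> i != x ->
  on x y i -> on x z i -> False.
Proof.
rewrite /on => xy xz yz ix; rewrite dotC => h1; rewrite dotC => h2.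
have n0 : cross (cross (v x) (v y)) (cross (v x) (v z)) != 0.
  by rewrite cross_crossl scaler_eq0 negb_or v_neq0 andbT indep.
have [c] := perp_cross h1 h2 n0; rewrite cross_crossl scalerA => e.
have xi : x != i by rewrite eq_sym.
exact: (displacement_not_parallel u_perp u_ext xi e).
Qed.

Lemma tied_or_between i j k l :
  i != j -> i != k -> i != l -> j != k -> j != l -> k != l ->
  tied j k i \/ between i j k l.
Proof.
move=> ij ik il jk jl kl.
(* The coefficients of Cramer's linear relation between the four directions, which make the scaled
   directions sum to 0. *)
pose p := det (v l) (v j) (v k); pose q := det (v i) (v l) (v k).
pose r := det (v i) (v j) (v l); pose t := - det (v i) (v j) (v k).
have p0 : p != 0 by apply: indep; rewrite // eq_sym.
have q0 : q != 0 by apply: indep; rewrite // eq_sym.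
have r0 : r != 0 by apply: indep.
have t0 : t != 0 by rewrite oppr_eq0; apply: indep.
set vi := p *: v i; set vj := q *: v j; set vk := r *: v k; set vl := t *: v l.
have vlE : vl = - (vi + vj + vk) by rewrite /vl /t scaleNr cramer3.
pose A := cross vi vj; pose B := cross vi vk; pose C := cross vj vk.
have ilE : cross vi vl = - A - B.
  by rewrite vlE /A /B; apply: row3P; rewrite !vecE; split; lra.
have jlE : cross vj vl = A - C.
  by rewrite vlE /A /C; apply: row3P; rewrite !vecE; split; lra.
have klE : cross vk vl = B + C.
  by rewrite vlE /B /C; apply: row3P; rewrite !vecE; split; lra.
have ext x y (c d : R) : x != y -> c != 0 -> d != 0 ->
    let n := cross (c *: v x) (d *: v y) in exists s : bool,
    (if s then extremal (fun k => dot n (a k)) x y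
     else extremal (fun k => dot n (a k)) y x) /\
    exists2 b, 0 < b & u x y = (if s then b else - b) *: n.
  move=> xy c0 d0 n.
  have nE : n = (c * d) *: cross (v x) (v y) by rewrite /n crossZl crossZr scalerA.
  apply: (normal_extremal_sign u_perp u_perp' u_ext) => //.
  - by rewrite nE dotZl dot_cross_l mulr0.
  - by rewrite nE dotZl dot_cross_r mulr0.
  - exact: not_parallel.
  - by rewrite nE scaler_eq0 mulf_eq0 !negb_or c0 d0 not_parallel.
have [s12 [e12 [c12 c12_gt0 u12]]] := ext i j p q ij p0 q0.
have [s13 [e13 [c13 c13_gt0 u13]]] := ext i k p r ik p0 r0.
have [s14 [e14 [c14 c14_gt0 u14]]] := ext i l p t il p0 t0.
have [s23 [e23 _]] := ext j k q r jk q0 r0.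
have [s24 [e24 _]] := ext j l q t jl q0 t0.
have [s34 [e34 _]] := ext k l r t kl r0 t0.
move: e12 e13 e14 e23 e24 e34 u12 u13 u14.
rewrite -/vi -/vj -/vk -/vl ilE jlE klE -/A -/B -/C => e12 e13 e14 e23 e24 e34 u12 u13 u14.
have spr (f : I -> R) (s : bool) x y z w :
    (if s then extremal f x y else extremal f y x) ->
    if s then spread (f x) (f y) (f z) (f w) else spread (f y) (f x) (f z) (f w).
  by case: s => -[h h'].
have := spr _ _ _ _ i j e34; have := spr _ _ _ _ i k e24.
have := spr _ _ _ _ i l e23; have := spr _ _ _ _ j k e14.
have := spr _ _ _ _ j l e13; have := spr _ _ _ _ k l e12.
rewrite !dotDl !dotNl => h12 h13 h14 h23 h24 h34.
have CE : C = (q * r) *: cross (v j) (v k) by rewrite /C crossZl crossZr scalerA.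
have qr0 : q * r != 0 by rewrite mulf_neq0.
case: (four_lines_tie h12 h13 h14 h23 h24 h34).
- rewrite CE !dotZl => /(mulfI qr0) h.
  by left; left; rewrite /on dotB h subrr.
- rewrite CE !dotZl => /(mulfI qr0) h.
  by left; right; rewrite /on dotB crossC !dotNl h subrr.
(* Since [s14] is opposite to [s12] and [s13], the signs cancel in [cross vi vl = - A - B], and
   [u i l] is a positive combination of [u i j] and [u i k]. *)
- move=> [s13E s14E]; right; exists (c14 / c12), (c14 / c13).
  rewrite !divr_gt0 //; split => //; rewrite u14 u13 u12 s14E -s13E.
  have c12_0 := lt0r_neq0 c12_gt0; have c13_0 := lt0r_neq0 c13_gt0.
  by case: s12 {h12 e12 u12 s13E s14E} => /=;
     rewrite !scalerA ?mulrN !mulfVK // ?scaleNr scalerBr scalerN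
       ?opprB ?opprD ?opprK // addrC.
Qed.

(** If [c] were nonzero, [u i x] would be orthogonal to the independent directions [v i], [v x],
    [v y], hence zero. *)
Lemma normals_independent i x y (c d : R) : i != x -> i != y -> x != y ->
  c *: u i x = d *: u i y -> c = 0.
Proof.
move=> ix iy xy e; apply/eqP; apply/negPn/negP => c0.
have uy : dot (u i x) (v y) = 0.
  have := congr1 (fun n => dot n (v y)) e.
  rewrite /= !dotZl u_perp' // mulr0 => /eqP.
  by rewrite mulf_eq0 (negbTE c0) => /eqP.
have [b uE] := perp_cross (u_perp ix) (u_perp' ix) (not_parallel ix).
have b0 : b = 0.
  move: uy; rewrite uE dotZl => /eqP; rewrite mulf_eq0 => /orP[/eqP //|].
  by rewrite -/(det _ _ _) (negbTE (indep _ _ _)).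
by have [_] := u_ext ix; rewrite uE b0 !dotZl !mul0r ltxx.
Qed.

(** Eliminating [u i y] leaves a relation between two independent normals with a positive
    coefficient. *)
Lemma between_asym i x y z : i != x -> i != y -> i != z -> x != y -> x != z ->
  between i x y z -> between i x z y -> False.
Proof.
move=> ix iy iz xy xz [c [d [c0 d0 e]]] [c' [d' [c0' d0' e']]].
have h : (c + d * c') *: u i x = (1 - d * d') *: u i z.
  rewrite scalerBl scale1r {1}e e' scalerDr scalerDl !scalerA addrA.
  by rewrite -[RHS]addrA subrr addr0.
have := normals_independent ix iz xz h.
by have := mulr_gt0 d0 c0'; lra.
Qed.

Lemma between_cross i x y z w : i != x -> i != y -> i != z -> i != w -> x != y ->
  between i x y z -> between i x y w -> between i z w x -> False.
Proof.
move=> ix iy iz iw xy [c [d [c0 d0 e]]] [c' [d' [c0' d0' e']]] [b [b' [b0 b0' f]]].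
have h : (b * d + b' * d') *: u i y = (1 - (b * c + b' * c')) *: u i x.
  rewrite scalerBl scale1r {1}f e e' !scalerDr !scalerDl !scalerA.
  by rewrite addrACA addrC addrK.
have yx : y != x by rewrite eq_sym.
have := normals_independent iy ix yx h.
by have := mulr_gt0 b0 d0; have := mulr_gt0 b0' d0'; lra.
Qed.

(* Each of the four indices is the first argument of [on _ _ i] at most once,
   so five pairs cannot all be tied. *)
Lemma five_pairs_not_tied i x y z w :
  i != x -> i != y -> i != z -> i != w ->
  x != y -> x != z -> x != w -> y != z -> y != w -> z != w ->
  tied z w i -> tied x z i -> tied x w i -> tied y z i -> tied y w i -> False.
Proof.
move=> ix iy iz iw xy xz xw yz yw zw.
have [[yx zx wx] [zy wy wz]] : [/\ y != x, z != x & w != x] /\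
    [/\ z != y, w != y & w != z].
  by split; split; rewrite eq_sym.
have := @on_unique x y z i; have := @on_unique x y w i; have := @on_unique x z w i.
have := @on_unique y x z i; have := @on_unique y x w i; have := @on_unique y z w i.
have := @on_unique z x y i; have := @on_unique z x w i; have := @on_unique z y w i.
have := @on_unique w x y i; have := @on_unique w x z i; have := @on_unique w y z i.
rewrite /tied; tauto.
Qed.

(** If [x] and [y] are not tied, then [z] and [w] are both between them. By [between_asym] and
    [between_cross] the other five pairs are then tied, which is too many. *)
Lemma pair_tied i x y z w :
  i != x -> i != y -> i != z -> i != w ->
  x != y -> x != z -> x != w -> y != z -> y != w -> z != w -> tied x y i.
Proof.
move=> ix iy iz iw xy xz xw yz yw zw.
have [[yx zx wx] [zy wy wz]] : [/\ y != x, z != x & w != x] /\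
    [/\ z != y, w != y & w != z].
  by split; split; rewrite eq_sym.
have [//|bz] := tied_or_between ix iy iz xy xz yz.
have [//|bw] := tied_or_between ix iy iw xy xw yw.
exfalso; apply: (five_pairs_not_tied ix iy iz iw) => //.
- have [//|] := tied_or_between iz iw ix zw zx wx.
  by move=> b; case: (between_cross ix iy iz iw xy bz bw b).
- have [//|] := tied_or_between ix iz iy xz xy zy.
  by move=> b; case: (between_asym ix iy iz xy xz bz b).
- have [//|] := tied_or_between ix iw iy xw xy wy.
  by move=> b; case: (between_asym ix iy iw xy xw bw b).
- have [//|] := tied_or_between iy iz ix yz yx zx.
  move=> b; case: (@between_asym i y x z iy ix iz yx yz _ b).
  by case: bz => c [d [c0 d0 e]]; exists d, c; split; rewrite // addrC.
- have [//|] := tied_or_between iy iw ix yw yx wx.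
  move=> b; case: (@between_asym i y x w iy ix iw yx yw _ b).
  by case: bw => c [d [c0 d0 e]]; exists d, c; split; rewrite // addrC.
Qed.

Lemma five_lines_general_position i x y z w :
  i != x -> i != y -> i != z -> i != w ->
  x != y -> x != z -> x != w -> y != z -> y != w -> z != w -> False.
Proof.
move=> ix iy iz iw xy xz xw yz yw zw.
have [[yx zx wx] [zy wy wz]] : [/\ y != x, z != x & w != x] /\
    [/\ z != y, w != y & w != z].
  by split; split; rewrite eq_sym.
apply: (five_pairs_not_tied ix iy iz iw) => //.
- exact: (pair_tied iz iw ix iy).
- exact: (pair_tied ix iz iy iw).
- exact: (pair_tied ix iw iy iz).
- exact: (pair_tied iy iz ix iw).
- exact: (pair_tied iy iw ix iz).
Qed.

End GeneralPosition.

Lemma fresh_ord n (s : seq 'I_n) : (size s < n)%N -> exists x, x \notin s.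
Proof.
move=> sn; apply/existsP; rewrite -negb_forall; apply/negP => /forallP h.
have : (#|'I_n| <= size s)%N.
  apply: leq_trans (card_size s); apply: subset_leq_card.
  by apply/fintype.subsetP => x _; exact: h.
by rewrite card_ord leqNgt sn.
Qed.

Theorem no_five_lines (R : realType) (a v : 'I_5 -> 'rV[R]_3) (u : 'I_5 -> 'I_5 -> 'rV[R]_3) :
  (forall i, v i != 0) ->
  (forall i j, i != j -> dot (u i j) (v i) = 0) ->
  (forall i j, i != j -> dot (u i j) (v j) = 0) ->
  (forall i j, i != j -> extremal (fun k => dot (u i j) (a k)) i j) -> False.
Proof.
move=> v0 up up' ux.
have sym i j : cross (v i) (v j) = 0 -> cross (v j) (v i) = 0.
  by move=> h; rewrite crossC h oppr0.
have tr i j k := @cross_eq0_trans _ (v i) (v j) (v k) (v0 j) (v0 k).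
have [all|/existsNP[i0 /existsNP[k0 /eqP n0]]] :=
    pselect (forall i j, cross (v i) (v j) = 0).
  have [x0 _] := @fresh_ord 5 [::] isT.
  have [x1] := @fresh_ord 5 [:: x0] isT.
  have [x2] := @fresh_ord 5 [:: x0; x1] isT.
  have [x3] := @fresh_ord 5 [:: x0; x1; x2] isT.
  have [x4] := @fresh_ord 5 [:: x0; x1; x2; x3] isT.
  rewrite !inE !negb_or ![x4 == _]eq_sym => /and4P[h04 h14 h24 h34].
  rewrite ![x3 == _]eq_sym => /and3P[h03 h13 h23].
  rewrite ![x2 == _]eq_sym => /andP[h02 h12]; rewrite eq_sym => h01.
  exact: (five_not_parallel v0 up ux h01 h02 h03 h12 h13 h23 h04 h14 h24 h34).
(* If [v i] and [v j] are parallel but [v k] is not parallel to them, the two remaining directions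
   are parallel to [v k]. This is a parallel triple, which forces [v i] to be parallel as well. *)
have np i j : i != j -> cross (v i) (v j) != 0.
  move=> ij; apply/negP => /eqP pij.
  have [k nik] : exists k, cross (v i) (v k) != 0.
    have [p0|] := eqVneq (cross (v i) (v i0)) 0; last by exists i0.
    have [pk|] := eqVneq (cross (v i) (v k0)) 0; last by exists k0.
    by case/eqP: n0; exact: tr (sym _ _ p0) pk.
  have ik : i != k by apply: contra nik => /eqP ->; rewrite crossvv.
  have jk : j != k by apply: contra nik => /eqP <-; rewrite pij.
  have [l] := @fresh_ord 5 [:: i; j; k] isT.
  have [m] := @fresh_ord 5 [:: i; j; k; l] isT.
  rewrite !inE !negb_or ![m == _]eq_sym => /and4P[im jm km lm].
  rewrite ![l == _]eq_sym => /and3P[il jl kl].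
  have pk x : i != x -> j != x -> k != x -> cross (v k) (v x) = 0.
    move=> ix jx kx; have xk : x != k by rewrite eq_sym.
    have nix : cross (v i) (v x) != 0.
      apply: contra nik => /eqP pix; apply/eqP.
      exact: (three_parallel v0 up up' ux ij ix jx ik jk xk pij pix).
    exact: (two_parallel v0 up up' ux ij kx ik ix jk jx pij nik nix).
  have [pkl pkm] := (pk _ il jl kl, pk _ im jm km).
  have [ki li mi] : [/\ k != i, l != i & m != i] by split; rewrite eq_sym.
  have := three_parallel v0 up up' ux kl km lm ki li mi pkl pkm.
  by move=> /sym h; rewrite h eqxx in nik.
have [x0 _] := @fresh_ord 5 [::] isT.
have [x1] := @fresh_ord 5 [:: x0] isT.
have [x2] := @fresh_ord 5 [:: x0; x1] isT.
have [x3] := @fresh_ord 5 [:: x0; x1; x2] isT.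
have [x4] := @fresh_ord 5 [:: x0; x1; x2; x3] isT.
rewrite !inE !negb_or ![x4 == _]eq_sym => /and4P[h04 h14 h24 h34].
rewrite ![x3 == _]eq_sym => /and3P[h03 h13 h23].
rewrite ![x2 == _]eq_sym => /andP[h02 h12]; rewrite eq_sym => h01.
exact: (five_lines_general_position v0 up up' ux np h01 h02 h03 h04 h12 h13 h14 h23 h24 h34).
Qed.

(** * Clustered configurations *)

Section Limits.
Variables (R : realType) (U : set_system nat).
Context {FU : UltraFilter U}.
Hypothesis U_infty : \oo `<=` U.
Implicit Types (x y : nat -> R) (p q : nat -> 'rV[R]_3).

(** A cluster point of an ultrafilter is a limit. One ultrafilter thus replaces the successive
    extraction of subsequences. *)
Lemma bounded_ultra_cvg x : (forall n, `|x n| <= 1) -> cvg (x @ U).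
Proof.
move=> x1.
have UI : U (x @^-1` `[-1, 1]%classic).
  by apply: (filterS _ filterT) => n _ /=; rewrite in_itv /= -ler_norml.
have [l [_ xl]] := @segment_compact R (-1) 1 (x @ U) _ UI.
apply/cvg_ex; exists l => A Al.
have [//|Un] := in_ultra_setVsetC (x @^-1` A) FU.
by have [y [nAy Ay]] := xl (~` A) A Un Al.
Qed.

Lemma ultra_ge0 x l : (forall n, 0 <= x n) -> x @ U --> l -> 0 <= l.
Proof.
by move=> x0 xl; apply: (cvgr_to_ge xl); exact: nearW.
Qed.

Definition bounded_row p := forall n k, `|p n 0 k| <= 1.

Definition ulim p : 'rV[R]_3 := \row_k lim (p n 0 k @[n --> U]).

Lemma ulim_coord p k : bounded_row p -> p n 0 k @[n --> U] --> ulim p 0 k.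
Proof. by move=> p1; rewrite mxE; apply: bounded_ultra_cvg => n; exact: p1. Qed.

Lemma cvg_dot p q : bounded_row p -> bounded_row q ->
  dot (p n) (q n) @[n --> U] --> dot (ulim p) (ulim q).
Proof.
move=> p1 q1; under eq_fun do rewrite dot3E; rewrite dot3E.
by apply: cvgD; [apply: cvgD|]; apply: cvgM; exact: ulim_coord.
Qed.

Lemma ulim_close p q : bounded_row p -> bounded_row q ->
  (forall n k, `|p n 0 k - q n 0 k| <= n.+1%:R^-1) -> ulim p = ulim q.
Proof.
move=> p1 q1 pq; apply/rowP => k; apply/eqP; rewrite -subr_eq0 -normr_le0.
rewrite -oppr_ge0.
have h : (n.+1%:R^-1 - `|p n 0 k - q n 0 k|) @[n --> U] --> 0 - `|ulim p 0 k - ulim q 0 k|.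
  apply: cvgB; last by apply: cvg_norm; apply: cvgB; exact: ulim_coord.
  apply: cvg_trans (@cvg_harmonic R); exact: cvg_app.
by have := ultra_ge0 _ h; rewrite sub0r; apply => n; rewrite subr_ge0.
Qed.

End Limits.

(** * Combining separating functionals *)

Section Cone.
Variables (R : realType) (I : eqType) (a : I -> 'rV[R]_3).

Definition signed_on (b : bool) (w x : 'rV[R]_3) := if b then 0 <= dot w x else dot w x <= 0.

(** Nonnegative combinations with weights not both zero preserve the extremal points, and opposite
    signs at [x] allow a combination that vanishes there. *)
Lemma cone_combination i j (w1 w0 x : 'rV[R]_3) :
  extremal (fun k => dot w1 (a k)) i j -> extremal (fun k => dot w0 (a k)) i j ->
  signed_on true w1 x -> signed_on false w0 x ->
  exists c d : R, [/\ 0 <= c, 0 <= d, dot (c *: w1 + d *: w0) x = 0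
     & extremal (fun k => dot (c *: w1 + d *: w0) (a k)) i j].
Proof.
rewrite /signed_on => -[h1 h1'] [h0 h0'] x1 x0.
have key (c d : R) : 0 <= c -> 0 <= d -> 0 < c + d ->
    extremal (fun k => dot (c *: w1 + d *: w0) (a k)) i j.
  move=> c0 d0 cd; split.
    move=> k; have /andP[l1 r1] := h1 k; have /andP[l0 r0] := h0 k.
    by rewrite !dotDl !dotZl !lerD // ler_wpM2l.
  rewrite !dotDl !dotZl; have [cp|] := ltP 0 c.
    by rewrite ltr_leD ?ltr_pM2l // ler_wpM2l // ltW.
  move=> cn; rewrite ler_ltD ?ler_wpM2l ?(ltW h1') // ltr_pM2l //.
  by move: cd cn; clear; lra.
(* The weights used below could both vanish when [dot w1 x = 0]; then [w1] itself works. *)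
have [e1|n1] := eqVneq (dot w1 x) 0.
  exists 1, 0; split => //; first by rewrite dotDl !dotZl e1 mulr0 mul0r addr0.
  by apply: key; lra.
exists (- dot w0 x), (dot w1 x); split; rewrite ?oppr_ge0 //.
  by rewrite dotDl !dotZl mulNr mulrC addNr.
apply: key; rewrite ?oppr_ge0 //; apply: ltr_wpDl; rewrite ?oppr_ge0 //.
by rewrite lt_neqAle eq_sym n1.
Qed.

(* The four vectors [(dot w x, dot w y)] lie in the four closed quadrants, so
   their convex hull contains the origin. *)
Lemma quadrant_combination i j (w : bool -> bool -> 'rV[R]_3) (x y : 'rV[R]_3) :
  (forall b b', extremal (fun k => dot (w b b') (a k)) i j) ->
  (forall b b', signed_on b (w b b') x) -> (forall b b', signed_on (~~ b') (w b b') y) ->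
  exists u, [/\ dot u x = 0, dot u y = 0 & extremal (fun k => dot u (a k)) i j].
Proof.
move=> wij wx wy.
have half b' : exists u, [/\ dot u x = 0, signed_on (~~ b') u y
    & extremal (fun k => dot u (a k)) i j].
  have [c [d [c0 d0 ux ue]]] :=
    cone_combination (wij true b') (wij false b') (wx true b') (wx false b').
  exists (c *: w true b' + d *: w false b'); split => //.
  move: (wy true b') (wy false b'); rewrite /signed_on dotDl !dotZl.
  case: b' {ux ue} => /= h h'; last by rewrite addr_ge0 // mulr_ge0.
  by rewrite -oppr_ge0 opprD -!mulrN addr_ge0 // mulr_ge0 // oppr_ge0.
have [u1 [u1x u1y u1e]] := half true; have [u0 [u0x u0y u0e]] := half false.
have [c [d [_ _ uy ue]]] := cone_combination u0e u1e u0y u1y.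
by exists (c *: u0 + d *: u1); split; rewrite // dotDl !dotZl u0x u1x !mulr0 addr0.
Qed.

End Cone.

(** * Compactness: close pairs of points become lines *)

Section Clusters.
Variable R : realType.

(** Bounded functionals have limits, and a gap of at least 1 keeps the separation strict in the
    limit. *)
Definition clustered m (p : 'I_5 -> bool -> 'rV[R]_3)
    (w : 'I_5 -> 'I_5 -> bool -> bool -> 'rV[R]_3) :=
  [/\ forall i b k, `|p i b 0 k| <= 1,
    forall i, p i true != p i false,
    forall i k, `|p i true 0 k - p i false 0 k| <= m.+1%:R^-1
  & forall i j b b', i != j ->
    [/\ forall k, `|w i j b b' 0 k| <= 1,
      forall k c, dot (w i j b b') (p j b') <= dot (w i j b b') (p k c) <=
        dot (w i j b b') (p i b)
    & dot (w i j b b') (p j b') + 1 <= dot (w i j b b') (p i b)]].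

Definition unit_row (d : 'rV[R]_3) := (Num.sqrt (dot d d))^-1 *: d.

Lemma dot_ge0 (d : 'rV[R]_3) : 0 <= dot d d.
Proof. by rewrite dot3E -!expr2 !addr_ge0 ?sqr_ge0. Qed.

Lemma sqr_coord_le (d : 'rV[R]_3) k : d 0 k ^+ 2 <= dot d d.
Proof.
have h0 := sqr_ge0 (d 0 0); have h1 := sqr_ge0 (d 0 1); have h2 := sqr_ge0 (d 0 2%:R).
rewrite dot3E -!expr2; case: k => -[|[|[|//]]] k.
- by rewrite (_ : Ordinal k = 0); [lra|apply/val_inj].
- by rewrite (_ : Ordinal k = 1); [lra|apply/val_inj].
- by rewrite (_ : Ordinal k = 2%:R); [lra|apply/val_inj].
Qed.

Lemma dot_unit_row d : d != 0 -> dot (unit_row d) (unit_row d) = 1.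
Proof.
move=> d0; rewrite dotZ dotZl mulrA -invfM -expr2 sqr_sqrtr ?dot_ge0 // mulVf //.
by apply: contra d0 => /eqP /sqr_dot_eq0 ->.
Qed.

Lemma unit_row_bounded d k : `|unit_row d 0 k| <= 1.
Proof.
rewrite mxE normrM normfV (ger0_norm (sqrtr_ge0 _)).
have [d0|d0] := eqVneq d 0; first by rewrite d0 mxE normr0 mulr0.
have s0 : 0 < Num.sqrt (dot d d).
  rewrite sqrtr_gt0 lt_neqAle dot_ge0 eq_sym andbT.
  by apply: contra d0 => /eqP /sqr_dot_eq0 ->.
rewrite mulrC ler_pdivrMr // mul1r -sqrtr_sqr ler_sqrt ?dot_ge0 //.
exact: sqr_coord_le.
Qed.

Lemma no_fine_clusters : exists m, forall p w, ~ clustered m p w.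
Proof.
apply: contrapT => /forallNP none.
have /choice[P /choice[W cl]] : forall m, exists p w, clustered m p w.
  by move=> m; have /existsNP[p /existsNP[w /contrapT h]] := none m; exists p, w.
have [U [FU U_infty]] := ultraFilterLemma eventually_filter.
pose p i b n := P n i b.
(* [clustered] bounds no functional on the diagonal; the default 0 makes every sequence bounded. *)
pose w i j b b' n := if i == j then 0 else W n i j b b'.
pose v i n := unit_row (P n i true - P n i false).
have pb i b : bounded_row (p i b) by move=> n k; have [h _ _ _] := cl n; exact: h.
have wb i j b b' : bounded_row (w i j b b').
  move=> n k; rewrite /w; case: eqVneq => ij; first by rewrite mxE normr0.
  by have [_ _ _ /(_ i j b b' ij)[]] := cl n.
have vb i : bounded_row (v i) by move=> n k; exact: unit_row_bounded.
pose a i := ulim U (p i true); pose V i := ulim U (v i).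
pose L i j b b' := ulim U (w i j b b').
have ap i b : ulim U (p i b) = a i.
  case: b => //; apply/esym/ulim_close => // n k.
  by have [_ _ h _] := cl n; exact: h.
have V0 i : V i != 0.
  apply/negP => /eqP Vi.
  have h : dot (v i n) (v i n) @[n --> U] --> dot (V i) (V i) by exact: cvg_dot.
  have : 1 <= dot (V i) (V i).
    apply: (cvgr_to_ge h); apply: nearW => n; rewrite dot_unit_row //.
    by have [_ h' _ _] := cl n; rewrite subr_eq0; exact: h'.
  by rewrite Vi dot3E !mxE !mulr0 !addr0 ler10.
have wE i j b b' n : i != j -> w i j b b' n = W n i j b b'.
  by rewrite /w => /negbTE ->.
have dot_le i j b b' q q' c : i != j -> bounded_row q -> bounded_row q' ->
    (forall n, dot (W n i j b b') (q n) + c <= dot (W n i j b b') (q' n)) ->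
    dot (L i j b b') (ulim U q) + c <= dot (L i j b b') (ulim U q').
  move=> ij qb qb' h; rewrite -subr_ge0.
  apply: (ultra_ge0 (x := fun n => dot (w i j b b' n) (q' n) -
      (dot (w i j b b' n) (q n) + c))).
    by move=> n; rewrite wE // subr_ge0.
  apply: cvgB; first exact: cvg_dot.
  by apply: cvgD; [exact: cvg_dot|exact: cvg_cst].
have Lext i j b b' : i != j -> extremal (fun k => dot (L i j b b') (a k)) i j.
  move=> ij.
  have le k c l d s : (forall n, dot (W n i j b b') (P n k c) + s <=
      dot (W n i j b b') (P n l d)) ->
      dot (L i j b b') (a k) + s <= dot (L i j b b') (a l).
    by move=> h; rewrite -(ap k c) -(ap l d); exact: dot_le.
  have all n : forall k c, dot (W n i j b b') (P n j b') <= dot (W n i j b b') (P n k c) <=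
      dot (W n i j b b') (P n i b).
    by have [_ _ _ /(_ i j b b' ij)[_ h _]] := cl n.
  split.
    move=> k; apply/andP; split; rewrite -[leLHS]addr0.
      by apply: (le j b' k true) => n; rewrite addr0; have /andP[] := all n k true.
    by apply: (le k true i b) => n; rewrite addr0; have /andP[] := all n k true.
  have : dot (L i j b b') (a j) + 1 <= dot (L i j b b') (a i).
    by apply: (le j b' i b) => n; have [_ _ _ /(_ i j b b' ij)[]] := cl n.
  by apply: lt_le_trans; rewrite ltrDl.
(* [v k] is a positive multiple of the difference from the [false] point to the [true] point, so
   comparing the values at these two points gives the sign in the limit. *)
have Lsign i j b b' k (c : bool) : i != j ->
    (forall n, if c then dot (W n i j b b') (P n k false) <= dot (W n i j b b') (P n k true)
     else dot (W n i j b b') (P n k true) <= dot (W n i j b b') (P n k false)) ->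
    signed_on c (L i j b b') (V k).
  move=> ij h; have lim_dot : dot (w i j b b' n) (v k n) @[n --> U] -->
    dot (L i j b b') (V k) by exact: cvg_dot.
  have dotv n : dot (w i j b b' n) (v k n) =
      (Num.sqrt (dot (P n k true - P n k false) (P n k true - P n k false)))^-1 *
      (dot (W n i j b b') (P n k true) - dot (W n i j b b') (P n k false)).
    by rewrite wE // dotZ; congr (_ * _); rewrite dotB.
  rewrite /signed_on; case: c h => h.
    apply: (ultra_ge0 _ lim_dot) => n.
    by rewrite dotv mulr_ge0 ?invr_ge0 ?sqrtr_ge0 // subr_ge0 h.
  rewrite -oppr_ge0; apply: (ultra_ge0 _ (cvgN lim_dot)) => n /=.
  by rewrite oppr_ge0 dotv mulr_ge0_le0 ?invr_ge0 ?sqrtr_ge0 // subr_le0 h.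
have /choice[u hu] : forall ij : 'I_5 * 'I_5, exists u, ij.1 != ij.2 ->
    [/\ dot u (V ij.1) = 0, dot u (V ij.2) = 0
      & extremal (fun k => dot u (a k)) ij.1 ij.2].
  move=> [i j] /=; have [->|ij] := eqVneq i j; first by exists 0.
  have [|||u hu] := @quadrant_combination R _ a i j (L i j) (V i) (V j).
  - by move=> b b'; exact: Lext.
  - move=> b b'; apply: Lsign => // n.
    by have [_ _ _ /(_ i j b b' ij)[_ h _]] := cl n; case: b h => h;
      have /andP[] := h i false; have /andP[] := h i true.
  - move=> b b'; apply: Lsign => // n.
    by have [_ _ _ /(_ i j b b' ij)[_ h _]] := cl n; case: b' h => h;
      have /andP[] := h j false; have /andP[] := h j true.
  by exists u.
apply: (@no_five_lines R a V (fun i j => u (i, j))) => //.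
- by move=> i j ij; have [] := hu (i, j) ij.
- by move=> i j ij; have [] := hu (i, j) ij.
- by move=> i j ij; have [] := hu (i, j) ij.
Qed.

End Clusters.

(** * Antipodal pairs *)

Section Coordinates.
Variable R : realType.
Implicit Types (u x y z : 'rV[R]_3) (X : {fset 'rV[R]_3}).

Lemma exists_normal x : exists2 u, u != 0 & dot u x = 0.
Proof.
pose u : 'rV[R]_3 := \row_k [:: x 0 1; - x 0 0; 0]`_k.
have [u0|] := eqVneq u 0; last by exists u => //; rewrite !vecE /=; lra.
have h0 : x 0 0 = 0 by move/rowP/(_ 1): u0; rewrite !mxE /=; lra.
exists (\row_k [:: 1; 0; 0]`_k); last by rewrite !vecE /= h0; lra.
by apply/eqP => /rowP/(_ 0); rewrite !mxE /= => /eqP; rewrite oner_eq0.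
Qed.

Lemma aff_hull_not_in_plane (A : set 'rV[R]_3) u (b : R) :
  aff_hull A = setT -> u != 0 -> A `<=` [set x | dot u x = b] -> False.
Proof.
move=> AT u0 Ab.
have hull : aff_hull A `<=` [set x | dot u x = b].
  apply: smallest_sub => // x y t /= xb yb.
  by rewrite dotD !dotZ xb yb -mulrDl subrKC mul1r.
rewrite AT in hull; have := hull 0 I; have := hull u I => /= h1 h2.
move/eqP: u0; apply; apply: sqr_dot_eq0; rewrite h1 -h2 dot3E !mxE !mulr0 !addr0 //.
Qed.

(** Otherwise [X] lies in a plane, whose normal is chosen according to whether [X] spans a plane, a
    line or at most a point. *)
Lemma nondegenerate_simplex X : aff_hull [set` X] = setT ->
  exists y0 y1 y2 y3, [/\ y0 \in X, y1 \in X, y2 \in X & y3 \in X] /\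
    det (y1 - y0) (y2 - y0) (y3 - y0) != 0.
Proof.
move=> XT; apply: contrapT => none.
have [X0|[y0 yX]] := fset_0Vmem X.
  by apply: (aff_hull_not_in_plane (u := const_mx 1) (b := 0) XT);
    [apply/eqP => /rowP/(_ 0); rewrite !mxE => /eqP; rewrite oner_eq0
    |move=> x /=; rewrite X0 inE].
have flat u : u != 0 -> (forall x, x \in X -> dot u (x - y0) = 0) -> False.
  move=> u0 h; apply: (aff_hull_not_in_plane (b := dot u y0) XT u0) => x /= xX.
  by apply/eqP; rewrite -subr_eq0 -dotB h.
have [line|/existsNP[y1 /not_implyP[y1X /existsNP[y2 /not_implyP[y2X /eqP n0]]]]] :=
  pselect (forall y1, y1 \in X -> forall y2, y2 \in X -> cross (y1 - y0) (y2 - y0) = 0);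
  last first.
  apply: (flat _ n0) => y3 y3X; apply: contrapT => /eqP d0; apply: none.
  by exists y0, y1, y2, y3.
have [point|/existsNP[y1 /not_implyP[y1X /eqP y10]]] :=
  pselect (forall y, y \in X -> y - y0 = 0).
  have [u u0 _] := exists_normal 0; apply: (flat u u0) => x xX.
  by rewrite point // dot3E !mxE !mulr0 !addr0.
have [u u0 uy] := exists_normal (y1 - y0); apply: (flat u u0) => x xX.
by have [c ->] := cross_eq0 y10 (line x xX y1 y1X); rewrite dotZ uy mulr0.
Qed.

(* In the barycentric coordinates of a simplex of maximal volume with vertices
   in [X], the points of [X] have coordinates in [-1, 1]. *)
Lemma bounded_coordinates X : aff_hull [set` X] = setT ->
  exists (lam : 'rV[R]_3 -> 'rV[R]_3) (y0 : 'rV[R]_3) (y : 'I_3 -> 'rV[R]_3),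
  [/\ y0 \in X, forall k, y k \in X, injective lam,
    forall x k, x \in X -> `|lam x 0 k| <= 1
  & forall u x, dot u (x - y0) = dot (\row_k dot u (y k - y0)) (lam x)].
Proof.
move=> XT; have [z0 [z1 [z2 [z3 [[z0X z1X z2X z3X] dz]]]]] := nondegenerate_simplex XT.
pose vol (t : X * X * X * X) :=
  `|det (val t.1.1.2 - val t.1.1.1) (val t.1.2 - val t.1.1.1) (val t.2 - val t.1.1.1)|.
pose z := ([` z0X]%fset, [` z1X]%fset, [` z2X]%fset, [` z3X]%fset).
have [[[[y0 y1] y2] y3] _ vmax] :=
  @arg_maxP _ R (X * X * X * X)%type z xpredT vol isT.
pose e1 := val y1 - val y0; pose e2 := val y2 - val y0; pose e3 := val y3 - val y0.
pose D := det e1 e2 e3.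
have D0 : D != 0.
  by rewrite -normr_gt0; apply: lt_le_trans (vmax z isT); rewrite /vol /= normr_gt0.
(* By Cramer's rule each coordinate is, up to sign, the volume after one vertex is replaced by [x],
   divided by the maximal volume. *)
pose lam x : 'rV[R]_3 := \row_k ([:: det (x - val y0) e2 e3; det e1 (x - val y0) e3;
  det e1 e2 (x - val y0)]`_k / D).
pose y (k : 'I_3) := nth 0 [:: val y1; val y2; val y3] k.
have lam0 x : lam x 0 0 = det (x - val y0) e2 e3 / D by rewrite mxE.
have lam1 x : lam x 0 1 = det e1 (x - val y0) e3 / D by rewrite mxE.
have lam2 x : lam x 0 2%:R = det e1 e2 (x - val y0) / D by rewrite mxE.
have lamE x : x - val y0 = lam x 0 0 *: e1 + lam x 0 1 *: e2 + lam x 0 2%:R *: e3.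
  rewrite lam0 lam1 lam2 ![_ / D]mulrC -!scalerA -!scalerDr -cramer3 -/D.
  by rewrite scalerA mulVf // scale1r.
exists lam, (val y0), y; split.
- exact: valP.
- by move=> [[|[|[|//]]] k] /=; exact: valP.
- move=> x x' xx'; apply: (@addIr _ (- val y0)).
  by rewrite [LHS]lamE [RHS]lamE xx'.
- move=> x k xX; rewrite mxE normrM normfV ler_pdivrMr ?normr_gt0 // mul1r.
  case: k => -[|[|[|//]]] k /=.
  + exact: (vmax (y0, [` xX]%fset, y2, y3) isT).
  + exact: (vmax (y0, y1, [` xX]%fset, y3) isT).
  + exact: (vmax (y0, y1, y2, [` xX]%fset) isT).
- by move=> u x; rewrite lamE !dotD !dotZ [RHS]dot3E !mxE /=; lra.
Qed.

End Coordinates.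

(** * From antipodal pairs to clustered configurations *)

Section Antipodal.
Variable R : realType.
Implicit Types (x y z : 'rV[R]_3) (X : {fset 'rV[R]_3}).

(** Parallelism makes the two supporting functionals proportional. A positive factor would make the
    hyperplanes equal, so it is negative, and [u] alone is maximal at [x] and minimal at [z]. *)
Lemma antipodal_functional X x z : antipodal X x z ->
  exists u : 'rV[R]_3, (forall y, y \in X -> dot u z <= dot u y <= dot u x) /\
    dot u z < dot u x.
Proof.
move=> [xX zX xz [H1 [H2 [[u [b [u0 H1E P1 _]]] [u' [b' [u0' H2E P2 _]]]]]]].
move=> H12 [t tE] [H1x H2z].
have inP y : y \in X -> conv_hull [set` X] y by move=> yX; apply: sub_gen_smallest.
move: H1x H2z; rewrite H1E H2E /= => ub ub'.
have uu : dot u u != 0 by apply: contra u0 => /eqP/sqr_dot_eq0 ->.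
have par y : dot u y = 0 -> dot u' y = 0.
  move=> uy; have H2t s : dot u s = b -> dot u' (t + s) = b'.
    move=> us; have : H2 (t + s) by rewrite tE; exists s; rewrite ?H1E.
    by rewrite H2E.
  have := H2t (x + y); have := H2t x ub; rewrite !dotD uy addr0 => h /(_ ub).
  by clear -h; lra.
pose k := dot u' u / dot u u.
have uE y : dot u' y = k * dot u y.
  have := par (dot u u *: y - dot u y *: u).
  rewrite !dotB !dotZ mulrC subrr => /(_ erefl) /eqP; rewrite subr_eq0 => /eqP h.
  by apply: (mulfI uu); rewrite h mulrA /k mulrCA mulfV // mulr1 mulrC.
have k0 : k != 0.
  by apply: contra u0' => /eqP k0; apply/eqP/sqr_dot_eq0; rewrite uE k0 mul0r.
have zx : dot u z != dot u x.
  apply/negP => /eqP zx; apply: H12; rewrite H1E H2E.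
  apply/seteqP; split => y /=; rewrite -ub' -ub !uE zx; first by move=> ->.
  by move/(mulfI k0).
have k_lt0 : k < 0.
  rewrite ltNge; apply/negP => k_ge0; have k_gt0 : 0 < k by rewrite lt_neqAle eq_sym k0.
  move/negP: zx; apply; rewrite eq_le; apply/andP; split.
    by rewrite ub; exact: P1 (inP _ zX).
  by have := P2 _ (inP _ xX); rewrite /= -ub' !uE ler_pM2l.
have zy y : y \in X -> dot u z <= dot u y.
  by move=> yX; have := P2 _ (inP _ yX); rewrite /= -ub' !uE ler_nM2l.
exists u; split; last by rewrite lt_neqAle zx zy.
by move=> y yX; rewrite zy //= ub; exact: P1 (inP _ yX).
Qed.

Let edge X (x y : X) := `[< antipodal X (val x) (val y) \/ antipodal X (val y) (val x) >].

Lemma edge_sym X : symmetric (@edge X).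
Proof. by move=> x y; apply/asboolP/asboolP => -[]; [right|left|right|left]. Qed.

Lemma edge_irr X : irreflexive (@edge X).
Proof. by move=> x; apply/asboolP => -[] [_ _]; rewrite eqxx. Qed.

Lemma edge_functional X (x z : X) : edge x z ->
  exists u : 'rV[R]_3, (forall y, y \in X -> dot u (val z) <= dot u y <= dot u (val x)) /\
    dot u (val z) < dot u (val x).
Proof.
move=> /asboolP[/antipodal_functional //|/antipodal_functional[u [h h']]].
exists (- u); split; last by rewrite !dotNl ltrN2.
by move=> y yX; rewrite !dotNl !lerN2 andbC h.
Qed.

(** Each unordered pair, with a boolean for its orientation, injects into the ordered edges. *)
Lemma nb_antipodal_sum_deg X :
  (2 * nb_antipodal X <= \sum_(x : X) deg (@edge X) [set: X]%SET x)%N.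
Proof.
have -> : (\sum_(x : X) deg (@edge X) [set: X]%SET x =
    #|[set p : X * X | edge p.1 p.2]%SET|)%N.
  transitivity (\sum_(x : X) \sum_(y : X | edge x y) 1)%N.
    by apply: eq_bigr => x _; rewrite /deg -sum1dep_card; apply: eq_bigl => y; rewrite inE.
  by rewrite pair_big_dep sum1dep_card.
rewrite /nb_antipodal; set E := [fset e in _ | _]%fset.
have rep (s : E) : exists p : X * X,
    antipodal X (val p.1) (val p.2) /\ val s = [fset val p.1; val p.2]%fset.
  have := valP s; rewrite !inE /= => /andP[_ /asboolP[x [y [xy ->]]]].
  by have [xX yX _ _] := xy; exists ([` xX]%fset, [` yX]%fset).
have [r hr] := choice rep.
pose g (t : E * bool) : X * X := if t.2 then r t.1 else ((r t.1).2, (r t.1).1).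
have gval t : val t.1 = [fset val (g t).1; val (g t).2]%fset.
  have [_ ->] := hr t.1; rewrite /g; case: t.2 => //=.
  by apply/fsetP => x; rewrite !inE orbC.
have g_inj : injective g.
  move=> [s b] [s' b'] e.
  have ss : s = s' by apply: val_inj; rewrite (gval (s, b)) (gval (s', b')) e.
  rewrite -{}ss in e *; congr pair; move: e; rewrite /g /=.
  have [[_ _ n12 _] _] := hr s; case: (r s) n12 => x y /= n12.
  by case: b; case: b' => // -[xy _]; move: n12; rewrite xy eqxx.
have -> : (2 * #|` E|)%N = #|[set g t | t : E * bool]%SET|.
  by rewrite card_imset // card_prod card_bool mulnC cardfE.
apply: subset_leq_card; apply/fintype.subsetP => p /imsetP[t _ ->]; rewrite inE.
have [h _] := hr t.1; apply/asboolP; rewrite /g; case: t.2 => /=; by [left|right].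
Qed.

Lemma same_cell_close m (x y : R) : `|x| <= 1 -> `|y| <= 1 ->
  Num.truncn ((x + 1) * m.+1%:R) = Num.truncn ((y + 1) * m.+1%:R) ->
  `|x - y| <= m.+1%:R^-1.
Proof.
rewrite !ler_norml => /andP[x0 _] /andP[y0 _] e.
have m0 : 0 < m.+1%:R :> R by rewrite ltr0n.
have pos (s : R) : -1 <= s -> 0 <= (s + 1) * m.+1%:R.
  by move=> s0; rewrite mulr_ge0 // ?ler0n //; lra.
have /andP[] := truncn_itv (pos _ x0); have /andP[] := truncn_itv (pos _ y0).
rewrite -e -(natr1 (Num.truncn _)); move: (Num.truncn _)%:R => c.
have -> : m.+1%:R^-1 = 1 / m.+1%:R :> R by rewrite div1r.
move=> h1 h2 h3 h4; apply/andP; split.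
  by rewrite lerNl ler_pdivlMr //; lra.
by rewrite ler_pdivlMr //; lra.
Qed.

Lemma few_antipodal_pairs : exists N, forall X, aff_hull [set` X] = setT ->
  (N <= #|` X|)%N -> (5 * nb_antipodal X <= 2 * #|` X| ^ 2)%N.
Proof.
have [m no_cluster] := no_fine_clusters R.
(* For a coordinate in [-1, 1], shifted by 1 and scaled by [m.+1], the integer part ranges from 0 to
   [2 * m.+1]. *)
have [N hN] := @monochromatic_blow_up {ffun 'I_3 -> 'I_((2 * m.+1).+1)}.
exists N => X XT NX; rewrite leqNgt; apply/negP => many.
have [lam [y0 [y [y0X yX lam_inj lam1 lamE]]]] := bounded_coordinates XT.
pose c (x : X) : {ffun 'I_3 -> 'I_((2 * m.+1).+1)} :=
  [ffun k => inord (Num.truncn ((lam (val x) 0 k + 1) * m.+1%:R))].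
have dense : (4 * #|{: X}| ^ 2 <= 5 * \sum_(x : X) deg (@edge X) [set: X]%SET x)%N.
  by have := nb_antipodal_sum_deg X; move: many; rewrite cardfE; lia.
have NX' : (N <= #|{: X}|)%N by rewrite -cardfE.
have [f [f_neq f_cell f_edge]] := hN _ _ c (@edge_sym X) (@edge_irr X) NX' dense.
pose p i b := lam (val (f i b)).
have /choice[U hU] : forall t : 'I_5 * 'I_5 * bool * bool, exists u : 'rV[R]_3,
    t.1.1.1 != t.1.1.2 -> (forall z, z \in X ->
      dot u (val (f t.1.1.2 t.2)) <= dot u z <= dot u (val (f t.1.1.1 t.1.2))) /\
    dot u (val (f t.1.1.2 t.2)) < dot u (val (f t.1.1.1 t.1.2)).
  move=> [[[i j] b] b'] /=; have [->|ij] := eqVneq i j; first by exists 0.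
  by have [u hu] := edge_functional (f_edge i j b b' ij); exists u.
(* Division by the gap makes the gap 1. The coordinates are differences of values of [u] on [X],
   hence at most 1 in absolute value. *)
pose w i j b b' : 'rV[R]_3 := let u := U (i, j, b, b') in
  (dot u (val (f i b)) - dot u (val (f j b')))^-1 *: \row_k dot u (y k - y0).
apply: (no_cluster p w); split.
- by move=> i b k; apply: lam1; exact: valP.
- by move=> i; apply: contra (f_neq i) => /eqP/lam_inj/val_inj ->.
- move=> i k; apply: same_cell_close; try by apply: lam1; exact: valP.
  have cell (x : X) : (Num.truncn ((lam (val x) 0 k + 1) * m.+1%:R)%R < (2 * m.+1).+1)%N.
    have := lam1 (val x) k (valP x); rewrite ler_norml => /andP[l0 l1].
    have pos : 0 <= (lam (val x) 0 k + 1) * m.+1%:R by rewrite mulr_ge0 ?ler0n //; lra.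
    have /andP[le_trunc _] := truncn_itv pos.
    rewrite ltnS -(ler_nat R) natrM; apply: le_trans le_trunc _.
    by rewrite ler_wpM2r ?ler0n //; lra.
  have /ffunP/(_ k) := f_cell i; rewrite !ffunE => /(congr1 val) /=.
  by rewrite !inordK ?cell.
- move=> i j b b' ij; have [/= ule ult] := hU (i, j, b, b') ij.
  set u := U _ in ule ult; pose g := dot u (val (f i b)) - dot u (val (f j b')).
  have g0 : 0 < g by rewrite subr_gt0.
  have wE x : dot (w i j b b') (lam x) = g^-1 * (dot u x - dot u y0).
    by rewrite /w dotZl -lamE dotB.
  split.
  + move=> k; rewrite !mxE normrM normfV (gtr0_norm g0) mulrC ler_pdivrMr // mul1r.
    rewrite dotB ler_norml /g; have /andP[] := ule _ (yX k); have /andP[] := ule _ y0X.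
    by clear; lra.
  + move=> k d; rewrite !wE !ler_pM2l ?invr_gt0 // !lerD2r.
    by apply: ule; exact: valP.
  + rewrite !wE -lerBrDl -mulrBr opprB addrA subrK -/g.
    by rewrite mulVf // gt_eqF.
Qed.

End Antipodal.

Theorem theorem1p1 (R : realType) :
  exists c : R, c < 2 /\
  exists g : nat -> R,
    g =O_\oo (fun n : nat => n%:R `^ c) /\
    forall n : nat, (4 <= n)%N ->
      max_antipodal R 3 n <= 2 / 5 * n%:R ^+ 2 + g n.
Proof.
have [N few] := few_antipodal_pairs R.
exists 1; split; first by rewrite ltr1n.
(* The error term absorbs the finitely many small [n] and vanishes from [N] on. *)
exists (fun n => if (n < N)%N then max_antipodal R 3 n else 0); split.
  apply/eqOP; near=> k.
  exists N => // n /= Nn; rewrite ltnNge Nn /= normr0.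
  by rewrite mulr_ge0 // ltW.
move=> n _; have sq : 0 <= 2 / 5 * n%:R ^+ 2 :> R.
  by rewrite mulr_ge0 ?exprn_ge0 ?ler0n // divr_ge0 // ler0n.
case: ltnP => [_|Nn]; first by rewrite lerDr.
rewrite addr0 /max_antipodal; set S := [set _ | _ in _].
have [[s Ss]|S0] := pselect (S !=set0); last first.
  (* The supremum of the empty set is 0 by convention. *)
  by rewrite (_ : S = set0) ?sup0 //; apply/eqP; apply: contrapT => /negP/set0P.
apply: ge_sup; first by exists s.
move=> _ [X [XT _ Xn] <-]; have := few X XT; rewrite Xn => /(_ Nn).
rewrite -(ler_nat R) !natrM expr2; lra.
Unshelve. all: by end_near. Qed.
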